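(* Let $Z_1=V_2/V_1$ and $Z_2=X_{a_1}/V_1$, let $\phi_2$ be a positive measurable function on $(0,\infty)\times\mathbb{R}$, and let $\delta_{\phi_2}=\phi_2(Z_1,Z_2)V_1$ be the corresponding estimator of $\sigma_1$. Let $Y\sim \mathrm{Gamma}(b-a+2,1)$ and let $\beta_1$ be the unique solution of $E L'(Y\beta_1)=0$. For $z_1>0$, $z_2>0$ define $$\phi_2^*(z_1,z_2)=\min\{\phi_2(z_1,z_2),\ \beta_1(1+z_1+(n_1-a_1+1)z_2)\}.$$ Then the estimator $$\delta_{\phi_2^*}=\begin{cases}\phi_2^*(Z_1,Z_2)V_1, & Z_1>0,\ Z_2>0,\\ \phi_2(Z_1,Z_2)V_1, & \text{otherwise,}\end{cases}$$ dominates $\delta_{\phi_2}$ with respect to the scale invariant loss $L$, provided that the event $\{Z_2>0,\ \phi_2(Z_1,Z_2)>\beta_1(1+Z_1+(n_1-a_1+1)Z_2)\}$ has nonzero probability.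
   Context: Fix integers $1\le a_i<b_i\le n_i$, $i=1,2$, and put $a=a_1+a_2$, $b=b_1+b_2$. The unknown parameter is $\theta=(\mu_1,\mu_2,\sigma_1,\sigma_2)$ with $\mu_1,\mu_2\in\mathbb{R}$ and $0<\sigma_1\le\sigma_2$. From a random sample of size $n_i$ from the exponential distribution with density $\sigma_i^{-1}e^{-(x-\mu_i)/\sigma_i}$, $x>\mu_i$, one observes only the order statistics of ranks $a_i,\dots,b_i$ (doubly type-II censored sample). A complete sufficient statistic is $(X_{a_1},X_{a_2},V_1,V_2)$, consisting of four independent random variables, where $X_{a_i}$ has density $$\frac{n_i!}{(a_i-1)!(n_i-a_i)!}\Big[1-e^{-\frac{x-\mu_i}{\sigma_i}}\Big]^{a_i-1}\frac1{\sigma_i}\Big[e^{-\frac{x-\mu_i}{\sigma_i}}\Big]^{n_i-a_i+1},\quad x>\mu_i,$$ and $V_i$ has the gamma distribution with shape $b_i-a_i$ and scale $\sigma_i$. $\mathrm{Gamma}(k,1)$ denotes the gamma distribution with shape $k$ and scale $1$. The loss for estimating $\sigma_1$ by $\delta$ is $L(\delta/\sigma_1)$, where $L$ is differentiable and: (i) $L(t)$ is bowl-shaped with minimum value $0$ attained at $t=1$, decreasing for $t\le1$ and increasing for $t\ge1$; (ii) all integrals involving $L$ are finite and differentiation under the integral sign is permissible. The risk is $R(\theta,\delta)=E_\theta L(\delta/\sigma_1)$. An estimator $\delta$ dominates $\delta'$ if $R(\theta,\delta)\le R(\theta,\delta')$ for all $\theta$, with strict inequality for at least one $\theta$. *)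

(* Defs.v *)
From HB Require Import structures.
From mathcomp Require Import all_boot all_order all_algebra.
From mathcomp Require Import all_classical all_reals all_analysis.
Set Implicit Arguments.
Unset Strict Implicit.
Unset Printing Implicit Defensive.
Import Order.TTheory GRing.Theory Num.Theory.
Import numFieldNormedType.Exports.
Local Open Scope classical_set_scope.
Local Open Scope ring_scope.

Record param (R : realType) := Param {
  mu1 : R;
  mu2 : R;
  sigma1 : R;
  sigma2 : R;
  sigma1_gt0 : 0 < sigma1;
  sigma1_le_sigma2 : sigma1 <= sigma2 }.

Section densities.
Context {R : realType}.

(* [a]-th order statistic of [n] exponential variables with location [m] and
   scale [s]. *)
Definition order_stat_pdf (n a : nat) (m s x : R) : R :=
  if m < x then
    (n`!)%:R / ((a - 1)`! * (n - a)`!)%:R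
      * (1 - expR (- ((x - m) / s))) ^+ (a - 1)
      * s^-1 * expR (- ((x - m) / s)) ^+ (n - a + 1)
  else 0.

(* All the shapes are positive integers, so the normalizing constant
   Gamma(k) is (k - 1)!. *)
Definition gamma_pdf (k : nat) (s x : R) : R :=
  if 0 < x then x ^+ (k - 1) * expR (- (x / s)) / ((k - 1)`!%:R * s ^+ k)
  else 0.

(* E g(Y) for Y ~ Gamma(k, 1). *)
Definition gamma_expectation (k : nat) (g : R -> R) : \bar R :=
  (\int[lebesgue_measure]_(y in `]0%R, +oo[) (g y * gamma_pdf k 1 y)%:E)%E.

End densities.

Section model.
Context {R : realType} {d : measure_display} {T : measurableType d}.

Definition has_density (P : probability T R) (X : {mfun T >-> R})
    (f : R -> R) : Prop :=
  forall A : set R, measurable A ->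
    distribution P X A = (\int[lebesgue_measure]_(x in A) (f x)%:E)%E.

(* Taking some of the sets equal to [setT] gives the product rule for the
   subfamilies. *)
Definition independent4 (P : probability T R) (X Y U V : {mfun T >-> R}) :
    Prop :=
  forall A B C D : set R,
    measurable A -> measurable B -> measurable C -> measurable D ->
    P (X @^-1` A `&` Y @^-1` B `&` U @^-1` C `&` V @^-1` D) =
      (P (X @^-1` A) * P (Y @^-1` B) * P (U @^-1` C) * P (V @^-1` D))%E.

Definition censored_law (n1 a1 b1 n2 a2 b2 : nat) (theta : param R)
    (P : probability T R) (X1 X2 V1 V2 : {mfun T >-> R}) : Prop :=
  [/\ independent4 P X1 X2 V1 V2,
      has_density P X1 (order_stat_pdf n1 a1 (mu1 theta) (sigma1 theta)),
      has_density P X2 (order_stat_pdf n2 a2 (mu2 theta) (sigma2 theta)),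
      has_density P V1 (gamma_pdf (b1 - a1) (sigma1 theta)) &
      has_density P V2 (gamma_pdf (b2 - a2) (sigma2 theta))].

Definition risk (L : R -> R) (P : param R -> probability T R)
    (theta : param R) (delta : T -> R) : \bar R :=
  'E_(P theta)[fun w => L (delta w / sigma1 theta)].

Definition dominates (L : R -> R) (P : param R -> probability T R)
    (delta delta' : T -> R) : Prop :=
  (forall theta, (risk L P theta delta <= risk L P theta delta')%E) /\
  (exists theta, (risk L P theta delta < risk L P theta delta')%E).

Variables X1 V1 V2 : T -> R.

Definition Z1 (w : T) : R := V2 w / V1 w.
Definition Z2 (w : T) : R := X1 w / V1 w.

Definition estimator (phi : R * R -> R) (w : T) : R :=
  phi (Z1 w, Z2 w) * V1 w.

Definition truncation_bound (n1 a1 : nat) (beta : R) (z : R * R) : R :=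
  beta * (1 + z.1 + (n1 - a1 + 1)%:R * z.2).

Definition phi_star (n1 a1 : nat) (beta : R) (phi : R * R -> R)
    (z : R * R) : R :=
  Num.min (phi z) (truncation_bound n1 a1 beta z).

Definition estimator_star (n1 a1 : nat) (beta : R) (phi : R * R -> R)
    (w : T) : R :=
  if (0 < Z1 w) && (0 < Z2 w) then estimator (phi_star n1 a1 beta phi) w
  else estimator phi w.

End model.

Section loss.
Context {R : realType}.

(* An estimate of a scale is positive, so only the values of [L] on (0, +oo)
   matter; its values elsewhere are junk. Monotonicity is not strict. *)
Definition bowl_shaped (L : R -> R) : Prop :=
  [/\ L 1 = 0,
      forall s t, 0 < s -> s <= t -> t <= 1 -> L t <= L s &
      forall s t, 1 <= s -> s <= t -> L s <= L t].

(* For W ~ Gamma(k, 1) and c > 0, E L(cW) and E[W L'(cW)] exist and are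
   finite, and d/dc E L(cW) = E[W L'(cW)]. *)
Definition gamma_regular (L : R -> R) (k : nat) : Prop :=
  forall c : R, 0 < c ->
    [/\ lebesgue_measure.-integrable `]0%R, +oo[
          (fun w => (L (c * w) * gamma_pdf k 1 w)%:E),
        lebesgue_measure.-integrable `]0%R, +oo[
          (fun w => (w * derive1 L (c * w) * gamma_pdf k 1 w)%:E) &
        is_derive (c : R^o) (1 : R^o)
          (fun x : R^o => fine (gamma_expectation k (fun w => L (x * w))) : R^o)
          (fine (gamma_expectation k (fun w => w * derive1 L (c * w))))].

End loss.

(* Main.v *)
(** Given [(Z1, Z2) = (z1, z2)] with [z1, z2 > 0], the density of [V1] is
    proportional to [rho(v)] times the density of [Gamma(b - a + 1)] with scale
    [sigma1 / (1 + z1 + (n1 - a1 + 1) z2)], where [rho] is nondecreasing because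
    [sigma1 <= sigma2]. For [beta < c] the function [w |-> L(c w) - L(beta w)]
    changes sign once, from negative to positive, so that if [c] is worse than
    [beta] under the gamma law, it remains worse after weighting by [rho].

    Under the gamma law, [c |-> E L(c W)] increases on [[beta1, +oo)]: its
    derivative is proportional to [E L'(c Y)], which is nonnegative there since
    [L'] changes sign once, and nonzero since [beta1] is the only root.

    At a parameter that charges the truncation event the inequality need not be
    strict: [rho] vanishes on part of the half-line when [mu1 > 0], and [L] may be
    flat on the rest. It is strict at [mu1 = 0], where [rho > 0]: since the laws
    of [(Z1, Z2)] have densities, the truncation set has positive planar measure. *)

Require Import Defs.
From HB Require Import structures.
From mathcomp Require Import all_boot all_order all_algebra.
From mathcomp Require Import all_classical all_reals all_analysis.
From mathcomp Require Import measurable_realfun ring zify.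
Import Order.TTheory GRing.Theory Num.Theory.
Import numFieldNormedType.Exports.
Local Open Scope classical_set_scope.
Local Open Scope ring_scope.

Local Notation pos := (`]0, +oo[%classic).

(** * Lebesgue measure and integration *)

(** The right-hand side is a measure in [A] that agrees with Lebesgue measure on the intervals []u,
    v]], and these determine it. *)
Lemma lebesgue_measure_scale (R : realType) (c : R) (A : set R) :
  0 < c -> measurable A ->
  lebesgue_measure A
    = (c%:E * lebesgue_measure ((fun x : R => (c * x)%R) @^-1` A))%E.
Proof.
move=> c0 mA.
pose phi : measurableTypeR R -> measurableTypeR R := fun x => c * x.
have mphi : measurable_fun setT phi by exact: measurable_funM.
pose nu : {measure set (measurableTypeR R) -> \bar R} :=
  mscale (NngNum (ltW c0)) (pushforward lebesgue_measure phi).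
rewrite (@lebesgue_measure_unique R (nu mphi)) //.
move=> X [[u v]] /= uv <-.
rewrite /= /mscale /= /pushforward.

have -> : phi @^-1` `]u, v] = `](u / c), (v / c)]%classic.
  apply/seteqP; split => x /=; rewrite !in_itv/= /phi;
   by rewrite ltr_pdivrMr// ler_pdivlMr// mulrC.
rewrite !lebesgue_measure_itv/= !lte_fin.
rewrite ltr_pM2r ?invr_gt0//. case: ifP => _; last by rewrite mule0.
by rewrite -EFinM; congr EFin; field; rewrite gt_eqF.
Qed.

Lemma ge0_integral_scale (R : realType) (c : R) (D : set R) (f : R -> \bar R) :
  0 < c -> measurable D -> measurable_fun D f -> (forall x, D x -> 0 <= f x)%E ->
  (\int[lebesgue_measure]_(x in D) f x
   = c%:E * \int[lebesgue_measure]_(x in (fun x => (c * x)%R) @^-1` D)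
        f (c * x)%R)%E.
Proof.
move=> c0 mD mf f0.
pose phi : measurableTypeR R -> measurableTypeR R := fun x => c * x.
have mphi : measurable_fun setT phi by exact: measurable_funM.
pose nu : {measure set (measurableTypeR R) -> \bar R} :=
  mscale (NngNum (ltW c0)) (pushforward lebesgue_measure phi).
transitivity (\int[nu mphi]_(x in D) f x)%E.
  apply: eq_measure_integral => A mA _ /=.
  exact: lebesgue_measure_scale.
rewrite /nu ge0_integral_mscale//=.
rewrite ge0_integral_pushforward//.
by move=> y /set_mem; exact: f0.
Qed.

Lemma preimage_scale_itvoy (R : realType) (c : R) : 0 < c ->
  (fun x => c * x) @^-1` `]0%R, +oo[ = `]0%R, +oo[%classic :> set R.
Proof. by move=> c0; apply/seteqP; split=> x /=; rewrite !in_itv/= !andbT pmulr_rgt0. Qed.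

Lemma integral_scale_itvoy (R : realType) (c : R) (f : R -> \bar R) :
  0 < c -> measurable_fun (`]0, +oo[%classic : set R) f ->
  (\int[lebesgue_measure]_(x in `]0%R, +oo[) f x
   = c%:E * \int[lebesgue_measure]_(x in `]0%R, +oo[) f (c * x)%R)%E.
Proof.
move=> c0 mf.
have H (g : R -> \bar R) : measurable_fun (`]0, +oo[%classic : set R) g ->
    (forall x, 0 <= g x)%E ->
    (\int[lebesgue_measure]_(x in `]0%R, +oo[) g x
    = c%:E * \int[lebesgue_measure]_(x in `]0%R, +oo[) g (c * x)%R)%E.
  move=> mg g0.
  by rewrite (@ge0_integral_scale R c _ g)// preimage_scale_itvoy.
rewrite integralE.
rewrite (H f^\+%E)//; last exact: measurable_funepos.
rewrite (H f^\-%E)//; last exact: measurable_funeneg.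
rewrite [in RHS]integralE.
have p1 : (0 <= \int[lebesgue_measure]_(x in `]0%R, +oo[) f^\+ (c * x)%R)%E
  by apply: integral_ge0 => x _; exact: funepos_ge0.
have p2 : (0 <= \int[lebesgue_measure]_(x in `]0%R, +oo[) f^\- (c * x)%R)%E
  by apply: integral_ge0 => x _; exact: funeneg_ge0.
have -> : ((fun x => f (c * x)%R)^\+ = fun x => f^\+ (c * x)%R)%E.
  by apply/funext => x; rewrite !funeposE.
have -> : ((fun x => f (c * x)%R)^\- = fun x => f^\- (c * x)%R)%E.
  by apply/funext => x; rewrite !funenegE.
set u := integral _ _ _ in p1 *; set v := integral _ _ _ in p2 *.
(* The integrals [u] and [v] of the two parts may be infinite, even both; multiplication by a finite
   [c > 0] still distributes over [u - v]. *)
have c1 : (0 < c%:E)%E by rewrite lte_fin.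
case: u v p1 p2 => [u||] [v||] // p1 p2; rewrite ?(gt0_muley, gt0_muleNy) //.
by rewrite muleBr.
Qed.

(** By uniqueness, [f] is almost everywhere the Radon-Nikodym derivative of [nu], for which the
    change of variables holds. *)
Lemma integral_density (R : realType) (nu : {finite_measure set (measurableTypeR R) -> \bar R})
    (f : R -> R) (g : R -> \bar R) :
  measurable_fun setT f -> (forall x, 0 <= f x) ->
  (forall A, measurable A -> nu A = \int[lebesgue_measure]_(x in A) (f x)%:E)%E ->
  measurable_fun setT g -> (forall x, 0 <= g x)%E ->
  (\int[nu]_x g x = \int[lebesgue_measure]_x (g x * (f x)%:E))%E.
Proof.
move=> mf f0 nuE mg g0.
have mEf : measurable_fun setT (EFin \o f) by exact/measurable_EFinP.
have numu : nu `<< (@lebesgue_measure R).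
  apply/null_content_dominatesP => A mA A0; rewrite nuE//.
  by rewrite null_set_integral//; exact: measurable_funTS.
have intf : (@lebesgue_measure R).-integrable setT (EFin \o f).
  apply/integrableP; split => //.
  under eq_integral do rewrite gee0_abs ?lee_fin//.
  by rewrite -nuE// ltey_eq fin_num_measure.
have mRN := measurable_int _ (Radon_Nikodym_SigmaFinite.f_integrable numu).
have ae : ae_eq lebesgue_measure setT (EFin \o f)
    (Radon_Nikodym_SigmaFinite.f nu (@lebesgue_measure R)).
  apply: (integral_ae_eq _ intf) => // E _ mE.
  by rewrite -(nuE E)// (Radon_Nikodym_SigmaFinite.f_integral numu).
rewrite -(Radon_Nikodym_SigmaFinite.change_of_variables numu)//.
apply: ge0_ae_eq_integral => //.
- exact: emeasurable_funM.
- exact: emeasurable_funM.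
- by move=> x _; rewrite mule_ge0// (Radon_Nikodym_SigmaFinite.f_ge0 numu).
- by move=> x _; rewrite mule_ge0// lee_fin.
- by apply: filterS ae => x /(_ Logic.I) <-.
Qed.

Section negligible.

Import HBNNSimple.

(** The integral of a nonnegative function, measurable or not, is a supremum over the simple
    functions below it, and a simple function may be set to 0 on [N] without changing its integral.
    The risk calls for this generality, since its integrand is controlled only almost surely. *)
Lemma eq_integral_off_null d (T : measurableType d) (R : realType)
  (mu : {measure set T -> \bar R}) (N : set T) (f g : T -> \bar R) :
  measurable N -> mu N = 0%E -> (forall x, ~ N x -> f x = g x) ->
  (\int[mu]_x f x = \int[mu]_x g x)%E.
Proof.
move=> mN N0 fg.
have mg (h : {nnsfun T >-> R}) :
    sintegral mu h = sintegral mu (proj_nnsfun h (measurableC mN)).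
  rewrite -!integralT_nnsfun.
  apply: ge0_ae_eq_integral => //.
  - by apply/measurable_EFinP.
  - by apply/measurable_EFinP.
  - by move=> x _; rewrite lee_fin.
  - by move=> x _; rewrite lee_fin.
  exists N; split => // x /= /not_implyP[_]; apply: contra_notP => Nx.
  by rewrite mindicE mem_set// mulr1.
have H (f1 g1 : T -> \bar R) : (forall x, ~ N x -> f1 x = g1 x) ->
   (forall x, 0 <= f1 x)%E -> (forall x, 0 <= g1 x)%E ->
  (\int[mu]_x f1 x <= \int[mu]_x g1 x)%E.
  move=> fg1 f0 g0; rewrite !ge0_integralTE//.
  apply: ge_ereal_sup => _ [h /= hf <-].
  rewrite mg; apply: ereal_sup_ubound.
  exists (proj_nnsfun h (measurableC mN)) => //= x.
  rewrite mindicE; case: (boolP (x \in ~` N)) => [/set_mem Nx|_].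
    by rewrite mulr1 -fg1.
  by rewrite mulr0.
have H2 (f1 g1 : T -> \bar R) : (forall x, ~ N x -> f1 x = g1 x) ->
   (forall x, 0 <= f1 x)%E -> (forall x, 0 <= g1 x)%E ->
  (\int[mu]_x f1 x = \int[mu]_x g1 x)%E.
  move=> fg1 f0 g0; apply/eqP; rewrite eq_le !H// => x Nx.
  by rewrite fg1.
rewrite integralE [RHS]integralE; congr (_ - _)%E.
  by apply: H2 => // x Nx; rewrite !funeposE fg.
by apply: H2 => // x Nx; rewrite !funenegE fg.
Qed.

End negligible.

(** * The joint law of the ratios *)

(* The product of two sigma-finite measures has no canonical sigma-finite
   structure: the instance for subprobabilities shadows it. *)
Section sigma_finite_product.
Context d1 d2 (T1 : measurableType d1) (T2 : measurableType d2) (R : realType).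
Variables (m1 : {sigma_finite_measure set T1 -> \bar R})
  (m2 : {sigma_finite_measure set T2 -> \bar R}).

Definition sigma_finite_product : set (T1 * T2) -> \bar R := (m1 \x m2)%E.

HB.instance Definition _ := Measure.copy sigma_finite_product (m1 \x m2)%E.

Lemma sigma_finite_product_sigma_finite : sigma_finite setT sigma_finite_product.
Proof.
have /sigma_finiteP[F [TF ndF Foo]] := sigma_finiteT m1.
have /sigma_finiteP[G [TG ndG Goo]] := sigma_finiteT m2.
exists (fun n => F n `*` G n).
  rewrite -setXTT TF TG predeqE => -[x y]; split.
    move=> [/= [n _ Fnx] [k _ Gky]]; exists (maxn n k) => //; split.
    - by move: x Fnx; exact/subsetPset/ndF/leq_maxl.
    - by move: y Gky; exact/subsetPset/ndG/leq_maxr.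
  by move=> [n _ []/= ? ?]; split; exists n.
move=> k; have [mF Fk] := Foo k; have [mG Gk] := Goo k.
split; first exact: measurableX.
by rewrite /sigma_finite_product product_measure1E// lte_mul_pinfty// ge0_fin_numE.
Qed.

HB.instance Definition _ := Measure_isSigmaFinite.Build _ _ _
  sigma_finite_product sigma_finite_product_sigma_finite.

End sigma_finite_product.
Arguments sigma_finite_product {d1 d2 T1 T2 R} m1 m2.

(* The display of [measurableTypeR R], which carries Lebesgue measure, is not
   that of [R]. *)
Definition lebesgue_measure2 {R : realType} :
    {sigma_finite_measure set (measurableTypeR R * measurableTypeR R)%type -> \bar R} :=
  sigma_finite_product lebesgue_measure lebesgue_measure.

(** The joint law is the product law, by two uses of the uniqueness of product measures: once for
    [(X, Y)] against [Z], and once for [X] against [Y] on the event that [Z] lies in [C]. *)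
Lemma integral_independent3 d d1 d2 d3 (T : measurableType d)
    (T1 : measurableType d1) (T2 : measurableType d2) (T3 : measurableType d3)
    (R : realType) (P : probability T R)
    (X : {mfun T >-> T1}) (Y : {mfun T >-> T2}) (Z : {mfun T >-> T3})
    (H : (T1 * T2) * T3 -> \bar R) :
  (forall A B C, measurable A -> measurable B -> measurable C ->
    P (X @^-1` A `&` Y @^-1` B `&` Z @^-1` C)
      = (P (X @^-1` A) * P (Y @^-1` B) * P (Z @^-1` C))%E) ->
  measurable_fun setT H -> (forall u, 0 <= H u)%E ->
  (\int[P]_w H ((X w, Y w), Z w)
   = \int[(distribution P X \x distribution P Y) \x distribution P Z]_u H u)%E.
Proof.
move=> indep mH H0.
have mXY : measurable_fun setT (fun w => (X w, Y w)).
  by apply/measurable_fun_pairP; split.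
have mXYZ : measurable_fun setT (fun w => ((X w, Y w), Z w)).
  exact/measurable_fun_pair.
transitivity (\int[pushforward P (fun w => ((X w, Y w), Z w))]_u H u)%E.
  by rewrite ge0_integral_pushforward.
apply: eq_measure_integral => A mA _.
apply/esym.
pose nu : {measure set ((T1 * T2) * T3)%type -> \bar R} :=
  pushforward P (fun w => ((X w, Y w), Z w)).
pose XY : probability (T1 * T2)%type R :=
  (distribution P X \x distribution P Y)%E.
pose DZ : probability T3 R := distribution P Z.
have U := @product_measure_unique _ _ _ _ R XY DZ (nu mXYZ).
apply: U; last exact: mA.
move=> B C mB mC.
rewrite /nu/= /pushforward/=.
have mZC : measurable (Z @^-1` C) by exact: measurable_funPTI.
have -> : (fun w => ((X w, Y w), Z w)) @^-1` (B `*` C)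
    = (fun w => (X w, Y w)) @^-1` B `&` Z @^-1` C by [].
have mB' : measurable ((fun w => (X w, Y w)) @^-1` B).
  by rewrite -[X in measurable X]setTI; exact: mXY.
(* If [Z] almost surely misses [C], both sides vanish. Otherwise [mu] below is the law of [(X, Y)]
   conditional on [Z] in [C], which is again the product of the laws of [X] and [Y]. *)
have [PC0|PC0] := eqVneq (P (Z @^-1` C)) 0%E.
  rewrite /distribution /pushforward PC0 mule0; apply/eqP.
  by rewrite eq_le measure_ge0 andbT -PC0 le_measure ?inE//; exact: measurableI.
pose c := fine (P (Z @^-1` C)).
have cE : P (Z @^-1` C) = c%:E by rewrite /c fineK// fin_num_measure.
have c0 : 0 < c by rewrite -lte_fin -cE lt0e PC0 measure_ge0.
have ci0 : 0 <= c^-1 by rewrite invr_ge0 ltW.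
pose mu : {measure set (T1 * T2)%type -> \bar R} :=
  mscale (NngNum ci0) (pushforward (mrestr P mZC) (fun w => (X w, Y w))).
rewrite -[in RHS](_ : mu mXY B = (distribution P X \x distribution P Y)%E B); last first.
  apply/esym.
  apply: product_measure_unique => //= A1 A2 mA1 mA2.
  rewrite /mscale/= /pushforward/= /mrestr.
  have -> : (fun w => (X w, Y w)) @^-1` (A1 `*` A2) `&` Z @^-1` C =
    X @^-1` A1 `&` Y @^-1` A2 `&` Z @^-1` C by [].
  rewrite indep// cE muleC -muleA -EFinM mulfV ?gt_eqF// mule1 //.
rewrite /mu/= /mscale/= /pushforward/= /mrestr /distribution /pushforward cE.
by rewrite muleC muleA -EFinM mulfV ?gt_eqF// mul1e.
Qed.

(* [v^-1] is [powR v (-1)] for [0 < v]; both inverses of [0] are [0]. *)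
Lemma measurable_inv (R : realType) : measurable_fun setT (@GRing.inv R).
Proof.
rewrite (_ : @GRing.inv R = fun v : R => if 0 <= v then v `^ (-1) else - (- v) `^ (-1)).
  apply: measurable_fun_ifT.
  - exact: measurable_fun_ler.
  - exact: measurable_powR.
  - apply: measurable_funN; apply: (measurableT_comp (measurable_powR (-1))).
    exact: oppr_measurable.
apply/funext => v; case: ifPn => [v0|]; first by rewrite powR_inv1.
by rewrite -ltNge => v0; rewrite powR_inv1 ?oppr_ge0 ?ltW// invrN opprK.
Qed.

(** At a fixed value [v] of [V1], substitute [V2 = v * z.1] and [X = v * z.2]; each substitution
    contributes a factor [v], whence [v ^+ 2]. *)
Lemma expectation_ratios_density d (T : measurableType d) (R : realType)
    (P : probability T R) (X V1 V2 : {mfun T >-> measurableTypeR R})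
    (fX g1 g2 : R -> R)
    (F : (measurableTypeR R * measurableTypeR R) * measurableTypeR R -> \bar R) :
  (forall A B C, measurable A -> measurable B -> measurable C ->
    P (V2 @^-1` A `&` X @^-1` B `&` V1 @^-1` C)
      = (P (V2 @^-1` A) * P (X @^-1` B) * P (V1 @^-1` C))%E) ->
  (forall A, measurable A -> P (X @^-1` A) = \int[lebesgue_measure]_(x in A) (fX x)%:E)%E ->
  (forall A, measurable A -> P (V1 @^-1` A) = \int[lebesgue_measure]_(x in A) (g1 x)%:E)%E ->
  (forall A, measurable A -> P (V2 @^-1` A) = \int[lebesgue_measure]_(x in A) (g2 x)%:E)%E ->
  measurable_fun setT fX -> measurable_fun setT g1 -> measurable_fun setT g2 ->
  (forall x, 0 <= fX x) -> (forall x, 0 <= g1 x) -> (forall x, 0 <= g2 x) ->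
  (forall v, v <= 0 -> g1 v = 0) ->
  measurable_fun setT F -> (forall u, 0 <= F u)%E ->
  (\int[P]_w F (((V2 w / V1 w)%R, (X w / V1 w)%R), V1 w)
   = \int[lebesgue_measure2]_z \int[@lebesgue_measure R]_v
       (F (z, v) * (fX (v * z.2) * g1 v * g2 (v * z.1) * v ^+ 2)%:E))%E.
Proof.
move=> indep dX d1 d2 mfX mg1 mg2 fX0 g10 g20 g1N mF F0.
pose RR := measurableTypeR R.
pose la := @lebesgue_measure R.
pose la2 := @lebesgue_measure2 R.
pose H (u : (RR * RR) * RR) := F ((u.1.1 / u.2, u.1.2 / u.2), u.2).
have mH : measurable_fun setT H.
  apply: measurableT_comp => //.
  have mV : measurable_fun setT (fun u : (RR * RR) * RR => (u.2^-1)%R).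
    by apply: measurableT_comp => //; exact: measurable_inv.
  apply: measurable_fun_pair; last exact: measurable_snd.
  apply: measurable_fun_pair; apply: measurable_funM => //.
  - exact: (measurableT_comp measurable_fst measurable_fst).
  - exact: (measurableT_comp measurable_snd measurable_fst).
transitivity (\int[P]_w H ((V2 w, X w), V1 w))%E; first by [].
rewrite (integral_independent3 _ _ _ _ _ _ _ _ _ _ _ _ _ H)//; last by move=> u; exact: F0.
pose D2X : probability (RR * RR)%type R :=
  (distribution P V2 \x distribution P X)%E.
rewrite (fubini_tonelli2 (m1 := D2X) (m2 := distribution P V1) H mH (fun u => F0 _)).
have mG := measurable_fun_fubini_tonelli_G
  (m1 := D2X) H mH (fun u => F0 _).
rewrite (@integral_density _ _ g1)//; last first.
  by move=> v; apply: integral_ge0 => *; exact: F0.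
pose h (u : (RR * RR) * RR) := fX (u.2 * u.1.2) * g1 u.2 * g2 (u.2 * u.1.1) * u.2 ^+ 2.
have h0 u : 0 <= h u.
  by apply: mulr_ge0; [apply: mulr_ge0 => //; exact: mulr_ge0|exact: sqr_ge0].
have m11 : measurable_fun setT (fun u : (RR * RR) * RR => u.1.1).
  exact: measurableT_comp measurable_fst measurable_fst.
have m12 : measurable_fun setT (fun u : (RR * RR) * RR => u.1.2).
  exact: measurableT_comp measurable_snd measurable_fst.
have mh : measurable_fun setT h.
  apply: measurable_funM; [apply: measurable_funM; [apply: measurable_funM|]|].
  - apply: measurableT_comp => //; exact: measurable_funM.
  - exact: measurableT_comp.
  - apply: measurableT_comp => //; exact: measurable_funM.
  - exact: measurable_funX.
pose Fh (u : (RR * RR) * RR) : \bar R := (F u * (h u)%:E)%E.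
have mFh : measurable_fun setT Fh.
  by apply: emeasurable_funM => //; exact/measurable_EFinP.
have Fh0 u : (0 <= Fh u)%E by rewrite mule_ge0// lee_fin.
rewrite -[RHS]/(\int[lebesgue_measure2]_z \int[la]_v Fh (z, v))%E.
rewrite (fubini_tonelli (m1 := (la2)%E) (m2 := la) Fh)//.
apply: eq_integral => v _ /=.
rewrite /fubini_G.
(* The substitutions are made for [0 < v]; elsewhere both sides vanish with [g1]. *)
have [v0|v0] := leP v 0.
  rewrite g1N// mule0; apply/esym/integral0_eq => z _.
  by rewrite /Fh /h/= g1N// mulr0 !mul0r mule0.
pose Fv (z : RR * RR) := F (z, v).
have mFv : measurable_fun setT Fv by exact: measurableT_comp.
have mHv : measurable_fun setT (fun z => H (z, v)) by exact: measurableT_comp.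
rewrite fubini_tonelli1//; last by move=> z; exact: F0.
have mHF := measurable_fun_fubini_tonelli_F (m2 := distribution P X)
  (fun z => H (z, v)) mHv (fun z => F0 _).
rewrite (@integral_density _ _ g2)//; last first.
  by move=> x; apply: integral_ge0 => *; exact: F0.
rewrite /fubini_F.
(* [K z1] is the integral over the second ratio after the substitution [x = v * z2], without the
   factor [v]. *)
pose K z1 := (\int[la]_z2 (Fv (z1, z2) * (fX (v * z2))%:E))%E.
have mFf : measurable_fun setT (fun z : RR * RR => Fv z * (fX (v * z.2))%:E)%E.
  apply: emeasurable_funM => //; apply/measurable_EFinP; apply: measurableT_comp => //.
  exact: measurable_funM.
have mK : measurable_fun setT K.
  apply: (measurable_fun_fubini_tonelli_F (m2 := la) (fun z => Fv z * (fX (v * z.2))%:E)%E) => //.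
  by move=> z; rewrite mule_ge0 ?lee_fin// F0.
have K0 z1 : (0 <= K z1)%E.
  by apply: integral_ge0 => z2 _; rewrite mule_ge0 ?lee_fin// F0.
have preT : (fun x : R => v * x) @^-1` setT = setT by exact: preimage_setT.
have mHx x1 : measurable_fun setT (fun y : RR => H ((x1, y), v)).
  exact: (measurableT_comp mHv (pair1_measurable (x1 : RR))).
have HE x1 : (\int[distribution P X]_y H (x1, y, v) = v%:E * K (x1 / v)%R)%E.
  rewrite (@integral_density _ _ fX)//; last 2 first.
  - exact: mHx.
  - by move=> x; exact: F0.
  rewrite (@ge0_integral_scale _ v setT)//; last 2 first.
  - apply: emeasurable_funM; last exact/measurable_EFinP.
    exact: mHx.
  - by move=> x _; rewrite mule_ge0 ?lee_fin// F0.
  rewrite preT; congr (_ * _)%E; apply: eq_integral => x _.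
  by rewrite /H/= mulrAC divff ?gt_eqF// mul1r.
under eq_integral do rewrite HE.
(* The substitution [x1 = v * z1] yields the other factor [v]. *)
rewrite (@ge0_integral_scale _ v setT)//; last 2 first.
- apply: emeasurable_funM; last exact/measurable_EFinP.
  apply: measurable_funeM; apply: (measurableT_comp mK).
  exact: measurable_funM.
- by move=> x _; rewrite !mule_ge0 ?lee_fin// ltW.
rewrite preT.
under eq_integral do rewrite (mulrAC v _ v^-1) divff ?gt_eqF// mul1r.
transitivity (\int[la]_z1 ((v ^+ 2 * g1 v * g2 (v * z1))%:E * K z1))%E.
  rewrite muleC muleA -EFinM -ge0_integralZl//; last 3 first.
  - apply: emeasurable_funM; last first.
      by apply/measurable_EFinP; apply: measurableT_comp => //; exact: measurable_funM.
    exact: measurable_funeM.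
  - by move=> x _; rewrite !mule_ge0 ?lee_fin// ltW.
  - by rewrite lee_fin mulr_ge0// ltW.
  apply: eq_integral => z1 _.
  rewrite -muleA (muleC (K _)) !muleA -!EFinM; congr (_%:E * _)%E.
  by rewrite expr2; ring.
have mFhv : measurable_fun setT (fun z => Fh (z, v)) by exact: measurableT_comp.
rewrite fubini_tonelli1//.
apply: eq_integral => z1 _; rewrite /fubini_F /K -ge0_integralZl//.
- apply: eq_integral => z2 _.
  rewrite /Fh/= muleCA -EFinM; congr (_ * _%:E)%E.
  by rewrite /h/=; ring.
- apply: emeasurable_funM; first exact: measurableT_comp.
  by apply/measurable_EFinP; apply: measurableT_comp => //; exact: measurable_funM.
- by move=> x _; rewrite mule_ge0 ?lee_fin// F0.
- by rewrite lee_fin !mulr_ge0// ltW.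
Qed.

(** * Bowl-shaped losses *)

Section bowl.
Context {R : realType}.
Variable L : R -> R.
Hypothesis bowl : bowl_shaped L.
Hypothesis dL : forall t : R, 0 < t -> derivable L t 1.

Lemma bowl_shaped_ge0 t : 0 < t -> 0 <= L t.
Proof.
case: bowl => L1 dec inc t0; rewrite -L1.
by have [t1|/ltW t1] := leP t 1; [exact: dec|exact: inc].
Qed.

(** Up to [w = c^-1] both arguments are at most 1, and from [w = b^-1] on both are at least 1. In
    between, [L (c * w)] increases and [L (b * w)] decreases, so that a zero of the difference,
    found there by the intermediate value theorem, separates the signs. *)
Lemma bowl_shaped_crossing b c : 0 < b -> b < c ->
  exists2 w0, 0 < w0 & forall w, 0 < w ->
    (w <= w0 -> L (c * w) <= L (b * w)) /\ (w0 <= w -> L (b * w) <= L (c * w)).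
Proof.
move=> b0 bc; have c0 := lt_trans b0 bc; case: bowl => L1 dec inc.
pose D (w : R) := L (c * w) - L (b * w).
have bV : 0 < b^-1 by rewrite invr_gt0.
have cV : 0 < c^-1 by rewrite invr_gt0.
have cb : c^-1 <= b^-1 by rewrite lef_pV2// ltW.
have cL (k w : R) : 0 < k -> 0 < w -> {for w, continuous (fun x : R => L (k * x))}.
  move=> k0 w0; apply: continuous_comp; first exact: mulrl_continuous.
  exact/differentiable_continuous/derivable1_diffP/dL/mulr_gt0.
have cD : {within `[c^-1, b^-1], continuous D}.
  apply: continuous_in_subspaceT => w; rewrite inE/= in_itv/= => /andP[cw _].
  have w0 : 0 < w by exact: lt_le_trans cw.
  by apply: continuousB; exact: cL.
have Dc : D c^-1 <= 0.
  rewrite /D divff ?gt_eqF// L1 sub0r oppr_le0.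
  by apply: bowl_shaped_ge0; exact: mulr_gt0.
have Db : 0 <= D b^-1.
  rewrite /D divff ?gt_eqF// L1 subr0.
  by apply: bowl_shaped_ge0; exact: mulr_gt0.
have [|w0 w0i Dw0] := @IVT R D _ _ 0 cb cD.
  by rewrite ge_min Dc le_max Db orbT.
exists w0.
  by rewrite (lt_le_trans cV)// (itvP w0i).
have w1 : 1 <= c * w0 by rewrite -ler_pdivrMl// mulr1 (itvP w0i).
have w2 : b * w0 <= 1 by rewrite -ler_pdivlMl// mulr1 (itvP w0i).
have w00 : 0 < w0 by rewrite (lt_le_trans cV)// (itvP w0i).
have E : L (c * w0) = L (b * w0) by apply/eqP; rewrite -subr_eq0; apply/eqP.
move=> w w_gt0; split=> ww0.
  have [cw|cw] := leP (c * w) 1.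
    by apply: dec => //; [exact: mulr_gt0|rewrite ler_pM2r// ltW].
  apply: (@le_trans _ _ (L (c * w0))).
    by apply: inc; [exact: ltW|rewrite ler_pM2l].
  by rewrite E; apply: dec => //; [exact: mulr_gt0|rewrite ler_pM2l].
have [bw|bw] := leP 1 (b * w).
  by apply: inc => //; rewrite ler_pM2r// ltW.
apply: (@le_trans _ _ (L (b * w0))).
  by apply: dec; [exact: mulr_gt0|rewrite ler_pM2l|exact: ltW].
by rewrite -E; apply: inc => //; rewrite ler_pM2l.
Qed.

Lemma bowl_shaped_derive1_le0 t : 0 < t -> t < 1 -> derive1 L t <= 0.
Proof.
case: bowl => L1 dec inc t0 t1.
apply: limr_le.
  (* The increment is [h] in [derive1] and [h *: 1] in [derivable]. *)
  under eq_fun; first (move=> h; rewrite -{2}(scaler1 h); over).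
  exact: dL.
near=> h.
have h0 : h != 0 by near: h; exact: nbhs_dnbhs_neq.
(* This bound keeps [h + t] between 0 and 1, where [L] decreases. *)
have : `|h| < Num.min t (1 - t).
  by near: h; apply: dnbhs0_lt; rewrite lt_min t0 subr_gt0.
rewrite lt_min !ltr_norml => /andP[/andP[ht _] /andP[_ ht1]].
have {}ht : 0 < h + t by rewrite -ltrBlDr sub0r.
have {}ht1 : h + t < 1 by rewrite -ltrBrDr.
move: h0; rewrite neq_lt => /orP[h0|h0].
- rewrite nmulr_rle0 ?invr_lt0// subr_ge0; apply: dec => //; last exact: ltW.
  by rewrite gerDr ltW.
- rewrite pmulr_rle0 ?invr_gt0// subr_le0; apply: dec => //; last exact: ltW.
  by rewrite lerDr ltW.
Unshelve. all: end_near. Qed.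

Lemma bowl_shaped_derive1_ge0 t : 1 < t -> 0 <= derive1 L t.
Proof.
case: bowl => L1 dec inc t1.
apply: limr_ge.
  under eq_fun; first (move=> h; rewrite -{2}(scaler1 h); over).
  by apply: dL; exact: lt_trans t1.
near=> h.
have h0 : h != 0 by near: h; exact: nbhs_dnbhs_neq.
have : `|h| < t - 1 by near: h; apply: dnbhs0_lt; rewrite subr_gt0.
rewrite ltr_norml opprB => /andP[]; rewrite ltrBlDr => ht _.
move: h0; rewrite neq_lt => /orP[h0|h0].
- rewrite nmulr_rge0 ?invr_lt0// subr_le0; apply: inc; first exact: ltW.
  by rewrite gerDr ltW.
- rewrite pmulr_rge0 ?invr_gt0// subr_ge0; apply: inc; first exact: ltW.
  by rewrite lerDr ltW.
Unshelve. all: end_near. Qed.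

End bowl.

(** * Gamma expectations *)

Lemma measurable_gamma_pdf (R : realType) k (s : R) (D : set R) :
  measurable_fun D (gamma_pdf k s).
Proof.
apply: measurable_funTS.
apply: measurable_fun_ifT => //; first exact: measurable_fun_ltr.
apply: measurable_funM => //; apply: measurable_funM; first exact: exprn_measurable.
apply: (measurableT_comp (@measurable_expR R)).
by apply: (measurableT_comp (@oppr_measurable R setT)); exact: mulrr_measurable.
Qed.

Lemma gamma_pdf_ge0 (R : realType) k (s x : R) : 0 < s -> 0 <= gamma_pdf k s x.
Proof.
move=> s0; rewrite /gamma_pdf; case: ifP => // x0.
by rewrite !mulr_ge0 ?expR_ge0 ?invr_ge0 ?mulr_ge0 ?exprn_ge0 ?ler0n// ltW.
Qed.

Lemma gamma_pdf_gt0 (R : realType) k (s x : R) : 0 < s -> 0 < x -> 0 < gamma_pdf k s x.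
Proof.
move=> s0 x0; rewrite /gamma_pdf x0.
by rewrite !mulr_gt0 ?expR_gt0 ?invr_gt0 ?mulr_gt0 ?exprn_gt0 ?ltr0n ?fact_gt0.
Qed.

Lemma gamma_pdf1_succ (R : realType) k (x : R) : (0 < k)%N ->
  gamma_pdf k.+1 1 x = k%:R^-1 * (x * gamma_pdf k 1 x).
Proof.
case: k => // k _; rewrite /gamma_pdf; case: ifP => _; last by rewrite !mulr0.
rewrite !subn1/= !expr1n !mulr1 factS natrM exprS invfM.
by ring.
Qed.


(** The density is positive on the half-line and can be divided out. In this way the measurability
    of [L] and of its derivative follows from the integrability in [gamma_regular]. *)
Lemma measurable_fun_gamma_mul (R : realType) k (g : R -> R) :
  measurable_fun (pos : set R) (fun x => g x * gamma_pdf k 1 x) ->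
  measurable_fun (pos : set R) g.
Proof.
move=> mg.
apply: (@eq_measurable_fun _ _ _ _ _ (fun x => g x * gamma_pdf k 1 x * (gamma_pdf k 1 x)^-1)).
  move=> x; rewrite inE/= in_itv/= andbT => x0.
  by rewrite mulfK// gt_eqF// gamma_pdf_gt0.
apply: measurable_funM => //.
by apply: (measurableT_comp (measurable_inv R)); exact: measurable_gamma_pdf.
Qed.

Lemma integrable_scale_itvoy (R : realType) (c : R) (f : R -> \bar R) : 0 < c ->
  measurable_fun (pos : set R) f ->
  (@lebesgue_measure R).-integrable pos (fun x => f (c * x)%R) ->
  (@lebesgue_measure R).-integrable pos f.
Proof.
move=> c0 mf /integrableP[_ fc]; apply/integrableP; split => //.
rewrite (integral_scale_itvoy _ c)//; last exact: measurableT_comp.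
by rewrite lte_mul_pinfty// lee_fin ltW.
Qed.

Section gamma_scale.
Context {R : realType}.
Variables (L : R -> R) (k : nat).
Hypothesis dL : forall t : R, 0 < t -> derivable L t 1.
Hypothesis bowl : bowl_shaped L.
Hypothesis k0 : (0 < k)%N.
Hypothesis reg : gamma_regular L k.

Lemma gamma_regular_measurable : measurable_fun (pos : set R) L.
Proof.
have [/measurable_int/measurable_EFinP/measurable_fun_gamma_mul mL _ _] := reg 1 ltr01.
by apply: eq_measurable_fun mL => x _; rewrite mul1r.
Qed.

Lemma gamma_regular_measurable_derive1 : measurable_fun (pos : set R) (derive1 L).
Proof.
have [_ /measurable_int/measurable_EFinP/measurable_fun_gamma_mul mL _] := reg 1 ltr01.
apply: (@eq_measurable_fun _ _ _ _ _ (fun x : R => x^-1 * (x * derive1 L (1 * x)))).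
  move=> x; rewrite inE/= in_itv/= andbT => x0.
  by rewrite mul1r mulKf// gt_eqF.
apply: measurable_funM => //.
exact: measurable_funTS (measurable_inv R).
Qed.

(** The weight [w] raises the shape by one. This identifies the equation for [beta1], under shape
    [k + 1], with the vanishing of the derivative of [c |-> E L(c W)] under shape [k]. *)
Lemma gamma_expectation_succ c : 0 < c ->
  gamma_expectation k.+1 (fun y => derive1 L (y * c))
  = ((k%:R^-1)%:E * gamma_expectation k (fun w => w * derive1 L (c * w))%R)%E.
Proof.
move=> c0; have [_ int _] := reg c c0.
rewrite /gamma_expectation -integralZl//.
apply: eq_integral => w _; rewrite -EFinM; congr EFin.
by rewrite gamma_pdf1_succ// (mulrC w c); ring.
Qed.

(* [E[W L'(c W)]] is the integral of [p c] divided by [(k - 1)! c ^ (k + 1)]: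
   substitute [t = c W]. *)
Let p (c t : R) := t ^+ k * derive1 L t * expR (- (t / c)).

Let A (c : R) := ((k.-1)`!%:R * c ^+ k)^-1.

Let A_gt0 c : 0 < c -> 0 < A c.
Proof. by move=> c0; rewrite invr_gt0 mulr_gt0 ?ltr0n ?fact_gt0 ?exprn_gt0. Qed.

Let pE c w : 0 < c -> 0 < w ->
  w * derive1 L (c * w) * gamma_pdf k 1 w = A c * p c (c * w).
Proof.
move=> c0 w0; rewrite /gamma_pdf w0 /p /A.
have -> : c * w / c = w by rewrite mulrAC divff ?mul1r// gt_eqF.
rewrite expr1n mulr1 divr1 subn1 exprMn -[in RHS](prednK k0) !exprS !prednK//.
field.
by rewrite !expf_neq0 ?gt_eqF// pnatr_eq0 -lt0n fact_gt0.
Qed.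

Let mp c : measurable_fun (pos : set R) (p c).
Proof.
apply: measurable_funM; last first.
  apply: (measurableT_comp (@measurable_expR R)).
  apply: (measurableT_comp (@oppr_measurable R setT)).
  exact: mulrr_measurable.
apply: measurable_funM; last exact: gamma_regular_measurable_derive1.
exact: exprn_measurable.
Qed.

Let Jp c : 0 < c ->
  (@lebesgue_measure R).-integrable pos (EFin \o p c) /\
  gamma_expectation k (fun w => w * derive1 L (c * w))%R
    = ((A c / c)%:E * \int[lebesgue_measure]_(t in pos) (p c t)%:E)%E.
Proof.
move=> c0; have [_ int _] := reg c c0.
have mEp : measurable_fun (pos : set R) (EFin \o p c) by exact/measurable_EFinP.
have intc : (@lebesgue_measure R).-integrable pos (fun w => (p c (c * w))%:E).
  have mpos : measurable (pos : set (measurableTypeR R)) by exact: measurable_itv.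
  have := integrableZl mpos (A c)^-1 int.
  apply: eq_integrable => // w; rewrite inE/= in_itv/= andbT => w0.
  rewrite pE// -EFinM mulKf// gt_eqF//; exact: A_gt0.
split; first exact: integrable_scale_itvoy intc.
rewrite (@integral_scale_itvoy R c (EFin \o p c))//= muleA -EFinM.
rewrite divfK ?gt_eqF// -integralZl//.
by apply: eq_integral => w; rewrite inE/= in_itv/= andbT => w0; rewrite pE.
Qed.

(* [L'] changes sign once, from negative to positive, at [1], and [p c / p b]
   is proportional to an increasing exponential. *)
Lemma gamma_derive_sign b c : 0 < b -> b < c ->
  (0 <= gamma_expectation k (fun w => w * derive1 L (b * w))%R ->
   0 <= gamma_expectation k (fun w => w * derive1 L (c * w))%R)%E.
Proof.
move=> b0 bc; have c0 := lt_trans b0 bc.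
have [ipb ->] := Jp b b0; have [ipc ->] := Jp c c0.
have mpos : measurable (pos : set (measurableTypeR R)) by exact: measurable_itv.
have Ab : (0 < (A b / b)%:E)%E by rewrite lte_fin divr_gt0// A_gt0.
have Ac : (0 < (A c / c)%:E)%E by rewrite lte_fin divr_gt0// A_gt0.
rewrite (pmule_rge0 _ Ab) (pmule_rge0 _ Ac) => pb.
(* [e] is the value at [t = 1] of the increasing ratio [expR (- (t / c)) / expR (- (t / b))]. Since
   [L'] changes sign at 1 as well, [e * p b t <= p c t] for all [t > 0]. *)
pose e := expR (b^-1 - c^-1).
apply: (@le_trans _ _ (\int[lebesgue_measure]_(t in pos) (e%:E * (p b t)%:E))%E).
  rewrite (integralZl mpos ipb).
  by rewrite mule_ge0// lee_fin expR_ge0.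
apply: le_integral => //; first by have := integrableZl mpos e ipb; apply: eq_integrable.
move=> t; rewrite inE/= in_itv/= andbT => t0; rewrite lee_fin.
have -> : e * p b t = t ^+ k * (derive1 L t * expR (b^-1 - c^-1 - t / b)).
  by rewrite /e /p (expRD (b^-1 - c^-1)); ring.
rewrite /p -mulrA ler_pM2l ?exprn_gt0//.
have bc' : 0 <= b^-1 - c^-1 by rewrite subr_ge0 lef_pV2// ltW.
have E : b^-1 - c^-1 - t / b = - (t / c) - (t - 1) * (b^-1 - c^-1) by ring.
have [t1|t1|t1] := ltgtP t 1.
- rewrite ler_wnM2l// ?bowl_shaped_derive1_le0// ler_expR E.
  by rewrite lerBrDl gerDr mulr_le0_ge0// subr_le0 ltW.
- rewrite ler_wpM2l// ?bowl_shaped_derive1_ge0// ler_expR E.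
  by rewrite gerBl mulr_ge0// subr_ge0 ltW.
- by rewrite E t1 subrr mul0r subr0.
Qed.

Lemma gamma_expectation_increasing b c : 0 < b -> b < c ->
  gamma_expectation k.+1 (fun y => derive1 L (y * b)) = 0%E ->
  (forall x, 0 < x -> gamma_expectation k.+1 (fun y => derive1 L (y * x)) = 0%E ->
    x = b) ->
  (gamma_expectation k (fun w => L (b * w)%R)
    < gamma_expectation k (fun w => L (c * w)%R))%E.
Proof.
move=> b0 bc Jb uniqb; have c0 := lt_trans b0 bc.
have ki : (0 < (k%:R^-1 : R)%:E)%E by rewrite lte_fin invr_gt0 ltr0n.
pose G (x : R) := fine (gamma_expectation k (fun w => L (x * w))).
pose J (x : R) := gamma_expectation k (fun w => w * derive1 L (x * w)).
have Jfin x : 0 < x -> J x \is a fin_num.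
  move=> x0; have [_ int _] := reg x x0.
  exact: integrable_fin_num.
have GE x : 0 < x -> gamma_expectation k (fun w => L (x * w)) = (G x)%:E.
  move=> x0; have [int _ _] := reg x x0.
  by rewrite /G fineK//; exact: integrable_fin_num.
have Gd (x : R) : 0 < x -> is_derive (x : R^o) (1 : R^o) (G : R^o -> R^o) (fine (J x)).
  by move=> x0; have [_ _] := reg x x0.
have J0 x : b < x -> 0 < fine (J x).
  move=> bx; have x0 := lt_trans b0 bx.
  (* Uniqueness of the root [b] excludes a zero derivative at [x]; the sign is inherited from [b],
     where the derivative vanishes. *)
  rewrite lt_neqAle; apply/andP; split.
    apply/eqP => Jx0.
    have := uniqb x x0; rewrite gamma_expectation_succ// -[X in (_ * X)%E]/(J x).
    rewrite -(fineK (Jfin x x0)) -Jx0 mule0 => /(_ erefl) xb.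
    by rewrite xb ltxx in bx.
  rewrite fine_ge0// (gamma_derive_sign b)//.
  by move: Jb; rewrite gamma_expectation_succ// => /eqP; rewrite mule_eq0 gt_eqF//= => /eqP ->.
rewrite !GE// lte_fin -subr_gt0.
have Gdin x : x \in `]b, c[ -> is_derive x 1 G (fine (J x)).
  by move=> xbc; apply: Gd; rewrite (lt_trans b0)// (itvP xbc).
have Gc : {within `[b, c], continuous G}.
  apply: continuous_in_subspaceT => x; rewrite inE/= in_itv/= => /andP[bx _].
  have x0 : 0 < x by exact: lt_le_trans bx.
  apply/differentiable_continuous/derivable1_diffP.
  by have [] := Gd x x0.
have [x xbc ->] := MVT bc Gdin Gc.
by rewrite mulr_gt0// ?J0 ?(itvP xbc)// subr_gt0.
Qed.

End gamma_scale.

(** * Comparison of integrals *)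

Section crossing.
Context {R : realType}.
Variables (L r g : R -> R) (b c : R).
Hypothesis dL : forall t : R, 0 < t -> derivable L t 1.
Hypothesis bowl : bowl_shaped L.
Hypothesis mL : measurable_fun (pos : set R) L.
Hypothesis mr : measurable_fun (pos : set R) r.
Hypothesis mg : measurable_fun (pos : set R) g.
Hypothesis r0 : forall w, 0 < w -> 0 <= r w.
Hypothesis g0 : forall w, 0 < w -> 0 <= g w.
Hypothesis r_nondecreasing : forall v w, 0 < v -> v <= w -> r v <= r w.
Hypothesis b0 : 0 < b.
Hypothesis bc : b < c.

(** With [g] a gamma density, the weight [h = r] gives the conditional risk up to a constant, and
    [h = cst 1] the plain gamma expectation. *)
Let I (k : R) (h : R -> R) :=
  (\int[lebesgue_measure]_(w in pos) (L (k * w) * (h w * g w))%:E)%E.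

Let mLk k : 0 < k -> measurable_fun (pos : set R) (fun w => L (k * w)).
Proof.
move=> k0; apply: (@measurable_comp _ _ _ _ _ _ (pos : set R)) => //.
move=> _ [w + <-]; rewrite /= !in_itv/= !andbT; exact: mulr_gt0.
Qed.

Let I_ge0 k h : 0 < k -> (forall w, 0 < w -> 0 <= h w) -> (0 <= I k h)%E.
Proof.
move=> k0 h0; apply: integral_ge0 => w; rewrite /= in_itv/= andbT => w0.
rewrite lee_fin; apply: mulr_ge0; last by rewrite mulr_ge0 ?h0 ?g0.
by apply: bowl_shaped_ge0 => //; exact: mulr_gt0.
Qed.

(** Both [r w - r w0] and [L (c * w) - L (b * w)] pass from nonpositive to nonnegative at the
    crossing [w0], so their product is nonnegative; it is integrated against [g]. Sums on both sides
    avoid differences of integrals that may be infinite. *)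
Lemma bowl_integral_crossing : exists2 w0, 0 < w0 &
  (I b r + (r w0)%:E * I c (cst 1%R) <= I c r + (r w0)%:E * I b (cst 1%R))%E.
Proof.
have c0 := lt_trans b0 bc.
have [w0 w00 cross] := bowl_shaped_crossing L bowl dL b c b0 bc.
exists w0 => //.
have mpos : measurable (pos : set (measurableTypeR R)) by exact: measurable_itv.
have mI k (h : R -> R) : 0 < k -> measurable_fun (pos : set R) h ->
    measurable_fun (pos : set R) (fun w => (L (k * w) * (h w * g w))%:E).
  move=> k0 mh; apply/measurable_EFinP; apply: measurable_funM; first exact: mLk.
  exact: measurable_funM.
have E k k' : 0 < k -> 0 < k' -> (I k r + (r w0)%:E * I k' (cst 1%R)
   = \int[lebesgue_measure]_(w in pos)
      (L (k * w) * (r w * g w) + r w0 * (L (k' * w) * g w))%:E)%E.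
  move=> k0 k'0.
  have Lk j w : 0 < j -> 0 < w -> 0 <= L (j * w).
    by move=> j0 w_gt0; apply: bowl_shaped_ge0 => //; exact: mulr_gt0.
  rewrite -ge0_integralZl//; last 3 first.
  - by apply: mI => //; exact: measurable_cst.
  - move=> w; rewrite /= in_itv/= andbT => w_gt0; rewrite lee_fin.
    by rewrite mulr_ge0 ?mulr_ge0 ?Lk ?g0.
  - by rewrite lee_fin r0.
  rewrite -ge0_integralD//.
  - by apply: eq_integral => w _; rewrite -EFinM -EFinD /= mul1r.
  - move=> w; rewrite /= in_itv/= andbT => w_gt0; rewrite lee_fin.
    by rewrite mulr_ge0 ?mulr_ge0 ?Lk ?g0 ?r0.
  - exact: mI.
  - move=> w; rewrite /= in_itv/= andbT => w_gt0.
    by rewrite lee_fin mulr_ge0 ?mulr_ge0 ?Lk ?g0 ?r0.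
  - by apply: measurable_funeM; apply: mI => //; exact: measurable_cst.
rewrite !E//; apply: ge0_le_integral => //.
- move=> w; rewrite /= in_itv/= andbT => w_gt0; rewrite lee_fin.
  by rewrite addr_ge0 ?mulr_ge0 ?g0 ?r0 ?bowl_shaped_ge0 ?mulr_gt0.
- apply/measurable_EFinP; apply: measurable_funD.
    by apply: measurable_funM; [exact: mLk|exact: measurable_funM].
  by apply: measurable_funM => //; apply: measurable_funM => //; exact: mLk.
- apply/measurable_EFinP; apply: measurable_funD.
    by apply: measurable_funM; [exact: mLk|exact: measurable_funM].
  by apply: measurable_funM => //; apply: measurable_funM => //; exact: mLk.
move=> w; rewrite /= in_itv/= andbT => w_gt0; rewrite lee_fin -subr_ge0.
have -> : L (c * w) * (r w * g w) + r w0 * (L (b * w) * g w)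
   - (L (b * w) * (r w * g w) + r w0 * (L (c * w) * g w))
   = g w * ((r w - r w0) * (L (c * w) - L (b * w))) by ring.
rewrite mulr_ge0 ?g0//.
have [crossl crossr] := cross w w_gt0.
have [ww0|/ltW ww0] := leP w w0.
  by rewrite mulr_le0// subr_le0; [exact: r_nondecreasing|exact: crossl].
by rewrite mulr_ge0// subr_ge0; [exact: r_nondecreasing|exact: crossr].
Qed.

Hypothesis Ib_lt_Ic : (I b (cst 1%R) < I c (cst 1%R))%E.
Hypothesis Ic_fin : (I c (cst 1%R) < +oo)%E.

(** As [r w0 >= 0], the term [r w0 * I c (cst 1)] of the crossing inequality may be lowered to
    [r w0 * I b (cst 1)], which is finite and cancels. The weighted integrals may be infinite. *)
Lemma bowl_integral_le : (I b r <= I c r)%E.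
Proof.
have c0 := lt_trans b0 bc.
have [w0 w00 H] := bowl_integral_crossing.
have rw0 : (0 <= (r w0)%:E)%E by rewrite lee_fin r0.
have Ibf : I b (cst 1%R) \is a fin_num.
  by rewrite ge0_fin_numE ?I_ge0// (lt_trans Ib_lt_Ic).
rewrite -(@leeD2rE _ ((r w0)%:E * I b (cst 1%R)))%E; last exact: fin_numM.
apply: le_trans H; apply: leeD2l.
by rewrite lee_wpmul2l// ltW.
Qed.

Lemma bowl_integral_lt : (forall w, 0 < w -> 0 < r w) -> (I c r < +oo)%E ->
  (I b r < I c r)%E.
Proof.
move=> rgt0 Icr; have c0 := lt_trans b0 bc.
have [w0 w00 H] := bowl_integral_crossing.
have rw0 : (0 < (r w0)%:E)%E by rewrite lte_fin rgt0.
have Ibf : I b (cst 1%R) \is a fin_num.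
  by rewrite ge0_fin_numE ?I_ge0// (lt_trans Ib_lt_Ic).
(* Finiteness of [I b r] lets the strict inequality between the unweighted integrals survive its
   addition. *)
have Ibrf : I b r \is a fin_num.
  rewrite ge0_fin_numE; last by apply: I_ge0 => // w w_gt0; exact: r0.
  exact: le_lt_trans bowl_integral_le Icr.
rewrite -(@lteD2rE _ ((r w0)%:E * I b (cst 1%R)))%E; last exact: fin_numM.
apply: lt_le_trans H; rewrite lteD2lE//.
by rewrite lte_pmul2l.
Qed.

End crossing.

(** Were the two integrals equal, [g - f] would vanish almost everywhere, both functions being
    integrable, and [B] would lie in a union of two null sets. *)
Lemma ge0_integral_lt d (T : measurableType d) (R : realType)
    (mu : {measure set T -> \bar R}) (f g : T -> \bar R) (B : set T) :
  measurable_fun setT f -> measurable_fun setT g ->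
  (forall x, 0 <= f x)%E -> (forall x, f x <= g x)%E ->
  (\int[mu]_x g x < +oo)%E -> measurable B -> mu B != 0%E ->
  (forall x, B x -> g x < +oo -> f x < g x)%E ->
  (\int[mu]_x f x < \int[mu]_x g x)%E.
Proof.
move=> mf mg f0 fg gfin mB B0 fltg.
have g0 x : (0 <= g x)%E by exact: le_trans (fg x).
have ig : mu.-integrable setT g.
  apply/integrableP; split => //.
  by under eq_integral do rewrite gee0_abs//.
have i_f : mu.-integrable setT f.
  by apply: le_integrable ig => // x _; rewrite !gee0_abs.
(* [A] is a null set containing the points where [g] is infinite; off it, [g - f] is a difference of
   finite numbers. *)
have [A [mA A0 gA]] := integrable_ae measurableT ig.
have gfinA x : ~ A x -> g x \is a fin_num.
  by move=> Ax; apply: contrapT => gx; apply: Ax; apply: gA => /(_ Logic.I).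
have ffinA x : ~ A x -> f x \is a fin_num.
  move=> /gfinA gx; rewrite ge0_fin_numE// (le_lt_trans (fg x))//.
  by rewrite -ge0_fin_numE.
pose D := setT `\` A.
have mD : measurable D by exact: measurableD.
have iD h : mu.-integrable setT h -> mu.-integrable D h.
  exact: integrableS.
rewrite lt_neqAle ge0_le_integral// andbT; apply: contra B0 => /eqP.
rewrite (ge0_negligible_integral mA measurableT mf)//.
rewrite (ge0_negligible_integral mA measurableT mg)// -/D => fgE.
have : (\int[mu]_(x in D) `|(g \- f) x| = 0)%E.
  transitivity (\int[mu]_(x in D) (g \- f) x)%E.
    apply: eq_integral => x /set_mem[_ Ax]; rewrite gee0_abs//=.
    by rewrite sube_ge0 ?fg// ffinA.
  rewrite integralB//; [|exact: iD|exact: iD].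
  by rewrite fgE subee//; apply: integrable_fin_num => //; exact: iD.
have mgf : measurable_fun D (g \- f)%E.
  by apply: emeasurable_funB; exact: measurable_funTS.
move=> /(ae_eq_integral_abs mu mD mgf)[A2 [mA2 A20 gfA2]].
rewrite -measure_le0.
apply: (@le_trans _ _ (mu (A `|` A2))).
  apply: le_measure; rewrite ?inE//; first exact: measurableU.
  move=> x Bx; have [Ax|Ax] := pselect (A x); [by left|right].
  apply: gfA2 => /= /(_ (conj Logic.I Ax)) /eqP.
  rewrite sube_eq ?ffinA ?gfinA//.
    rewrite add0e => /eqP E; have := fltg x Bx.
    by rewrite E ltxx -ge0_fin_numE// ffinA// => /(_ erefl).
by apply: (le_trans (measureU2 _ mA mA2)); rewrite [X in (X + _)%E]A0 [X in (_ + X)%E]A20 adde0.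
Qed.

(** * The density of the ratios *)

Lemma order_stat_pdf_ge0 (R : realType) n a (m s x : R) : 0 < s ->
  0 <= order_stat_pdf n a m s x.
Proof.
move=> s0; rewrite /order_stat_pdf; case: ifPn => // mx.
rewrite !mulr_ge0 ?exprn_ge0 ?expR_ge0 ?invr_ge0 ?ler0n ?(ltW s0)//.
by rewrite subr_ge0 -[leRHS]expR0 ler_expR oppr_le0 divr_ge0 ?subr_ge0 ?ltW.
Qed.

Lemma measurable_order_stat_pdf (R : realType) n a (m s : R) :
  measurable_fun setT (order_stat_pdf n a m s).
Proof.
have mE : measurable_fun setT (fun x : R => expR (- ((x - m) / s))).
  apply: (measurableT_comp (@measurable_expR R)).
  apply: (measurableT_comp (@oppr_measurable R setT)).
  by apply: measurable_funM => //; exact: measurable_funB.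
apply: measurable_fun_ifT => //; first exact: measurable_fun_ltr.
apply: measurable_funM; last exact: measurable_funX.
apply: measurable_funM => //; apply: measurable_funM => //.
by apply: measurable_funX; exact: measurable_funB.
Qed.

(** This is the joint density of the ratios at [z] and of [V1] at [v]; [v ^+ 2] is the Jacobian of
    the map from [z] to [(v * z.1, v * z.2)]. *)
Definition ratio_density {R : realType} (n1 a1 b1 a2 b2 : nat) (theta : param R)
    (z : R * R) (v : R) : R :=
  order_stat_pdf n1 a1 (mu1 theta) (sigma1 theta) (v * z.2)
  * gamma_pdf (b1 - a1) (sigma1 theta) v
  * gamma_pdf (b2 - a2) (sigma2 theta) (v * z.1) * v ^+ 2.

Section conditional.
Context {R : realType}.
Variables (n1 a1 b1 a2 b2 : nat) (theta : param R) (z : R * R).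
Hypothesis ab1 : (a1 < b1)%N.
Hypothesis ab2 : (a2 < b2)%N.
Hypothesis z1_gt0 : 0 < z.1.
Hypothesis z2_gt0 : 0 < z.2.

Let s := sigma1 theta.
Let t := sigma2 theta.
Let k := (b1 + b2 - (a1 + a2) + 1)%N.
Let m := 1 + z.1 + (n1 - a1 + 1)%:R * z.2.
Let s0 : 0 < s := sigma1_gt0 theta.
Let t0 : 0 < t := lt_le_trans s0 (sigma1_le_sigma2 theta).

Let m_gt0 : 0 < m.
Proof. by rewrite /m !addr_gt0// mulr_gt0// ltr0n addn1. Qed.

(* The density of [w = m v / sigma1] divided by the [Gamma(k, 1)] density, without
   the factors that do not depend on [w]. *)
Definition density_ratio (w : R) : R :=
  let v := s / m * w in
  if mu1 theta < v * z.2 then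
    (1 - expR (- ((v * z.2 - mu1 theta) / s))) ^+ (a1 - 1)
    * expR (z.1 * v * (s^-1 - t^-1))
  else 0.

(** Write [- (v * z.1 / t)] as [- (v * z.1 / s) + z.1 * v * (s^-1 - t^-1)]. The second term goes to
    [density_ratio]; the first joins the exponents of the other two densities to give
    [- (v * m / s) = - w], up to a constant in [mu1]. *)
Lemma ratio_densityE : exists2 C, 0 < C & forall w, 0 < w ->
  ratio_density n1 a1 b1 a2 b2 theta z (s / m * w)
  = C * (density_ratio w * gamma_pdf k 1 w).
Proof.
have [p Ep] : exists p, b1 = (a1 + p.+1)%N.
  by exists (b1 - a1).-1; rewrite prednK ?subn_gt0// subnKC// ltnW.
have [q Eq] : exists q, b2 = (a2 + q.+1)%N.
  by exists (b2 - a2).-1; rewrite prednK ?subn_gt0// subnKC// ltnW.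
(* The powers of [v] are [p] and [q] from the gamma densities and 2 from the Jacobian; a gamma
   density of shape [k] carries the power [k - 1]. *)
have Ek : k = (p + q + 2).+1.
  by rewrite /k Ep Eq; lia.
have E1 : (b1 - a1 = p.+1)%N by rewrite Ep addnC addnK.
have E2 : (b2 - a2 = q.+1)%N by rewrite Eq addnC addnK.
pose N := (n1 - a1 + 1)%N.
pose c0 : R := (n1`!)%:R / ((a1.-1)`! * (n1 - a1)`!)%:R.
pose C := c0 * s^-1 * expR (N%:R * (mu1 theta / s)) / (p`!%:R * s ^+ p.+1)
  * (z.1 ^+ q / (q`!%:R * t ^+ q.+1)) * (s / m) ^+ (p + q + 2) * (p + q + 2)`!%:R.
exists C.
  rewrite /C /c0.
  by do ![exact: expR_gt0 | rewrite ltr0n ?muln_gt0 ?fact_gt0 // | rewrite invr_gt0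
    | apply: exprn_gt0 | apply: mulr_gt0].
move=> w w0; rewrite /ratio_density /density_ratio /=.
set v := s / m * w.
have v0 : 0 < v by rewrite !mulr_gt0// invr_gt0.
have vw : v * m = s * w by rewrite /v; field; rewrite gt_eqF.
have VE : v ^+ (p + q + 2) = (s / m) ^+ (p + q + 2) * w ^+ (p + q + 2).
  by rewrite -exprMn.
clearbody v.
rewrite /order_stat_pdf; case: ifPn => // _; last by rewrite !mul0r mulr0.
rewrite -/s -/t /gamma_pdf v0 w0 mulr_gt0// E1 E2 Ek !subn1/= expr1n divr1 mulr1.
set E := expR (- ((v * z.2 - mu1 theta) / s)).
have EE : E ^+ N * expR (- (v / s)) * expR (- (v * z.1 / t))
    = expR (N%:R * (mu1 theta / s)) * expR (z.1 * v * (s^-1 - t^-1)) * expR (- w).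
  rewrite /E -expRM_natl -!expRD; congr expR.
  have -> : w = v * m / s by rewrite vw mulrAC divff ?mul1r// gt_eqF.
  by rewrite /m -/N; field; rewrite !gt_eqF.
rewrite /C -/N -/c0 in EE *.
transitivity (c0 * (1 - E) ^+ a1.-1 * s^-1 / (p`!%:R * s ^+ p.+1)
   * (z.1 ^+ q / (q`!%:R * t ^+ q.+1)) * v ^+ (p + q + 2)
   * (E ^+ N * expR (- (v / s)) * expR (- (v * z.1 / t)))).
  by rewrite -/N exprMn [v ^+ (p + q + 2)]exprD [v ^+ (p + q)]exprD; ring.
rewrite EE VE.
field.
by rewrite !expf_neq0 ?gt_eqF// ?ltr0n ?fact_gt0.
Qed.

Lemma density_ratio_ge0 w : 0 <= density_ratio w.
Proof.
rewrite /density_ratio /=; case: ifPn => // h.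
rewrite mulr_ge0 ?expR_ge0// exprn_ge0// subr_ge0 -[leRHS]expR0 ler_expR.
by rewrite oppr_le0 divr_ge0 ?subr_ge0 ?ltW.
Qed.

Lemma density_ratio_gt0 w : mu1 theta = 0 -> 0 < w -> 0 < density_ratio w.
Proof.
move=> mu0 w0; rewrite /density_ratio /= mu0.
have h : 0 < s / m * w * z.2 by rewrite !mulr_gt0// invr_gt0.
rewrite h subr0 mulr_gt0 ?expR_gt0// exprn_gt0// subr_gt0 -[ltRHS]expR0 ltr_expR.
by rewrite oppr_lt0 divr_gt0.
Qed.

(** Three factors grow with [w]: the indicator of the support, since [z.2 > 0]; the power of an
    exponential distribution function; and the last exponential, since [sigma1 <= sigma2]. *)
Lemma density_ratio_nondecreasing v w : v <= w ->
  density_ratio v <= density_ratio w.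
Proof.
move=> vw.
have sm : 0 <= s / m by rewrite divr_ge0// ltW.
have vw' : s / m * v <= s / m * w by rewrite ler_wpM2l.
have vwz : s / m * v * z.2 <= s / m * w * z.2 by rewrite ler_wpM2r// ltW.
rewrite {1}/density_ratio /=; case: ifPn => hv; last exact: density_ratio_ge0.
rewrite /density_ratio /= (lt_le_trans hv vwz).
have v1 : 0 <= 1 - expR (- ((s / m * v * z.2 - mu1 theta) / s)).
  rewrite subr_ge0 -[leRHS]expR0 ler_expR.
  by rewrite oppr_le0 divr_ge0 ?subr_ge0 ?ltW.
have v2 : 1 - expR (- ((s / m * v * z.2 - mu1 theta) / s)) <=
  1 - expR (- ((s / m * w * z.2 - mu1 theta) / s)).
  by rewrite lerD2l lerN2 ler_expR lerN2 ler_pM2r ?invr_gt0// lerD2r.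
apply: ler_pM; rewrite ?exprn_ge0 ?expR_ge0//.
  by rewrite lerXn2r// nnegrE// (le_trans v1).
rewrite ler_expR ler_wpM2r//.
  by rewrite subr_ge0 lef_pV2// ?posrE//; exact: sigma1_le_sigma2.
by rewrite ler_wpM2l// ltW.
Qed.

Lemma measurable_density_ratio : measurable_fun (pos : set R) density_ratio.
Proof.
apply: nondecreasing_measurable; first exact: measurable_itv.
exact: density_ratio_nondecreasing.
Qed.

End conditional.

(** * Conditional risk *)

(** Replacing the junk values of [L] by 0 makes the loss measurable and nonnegative on the whole
    line, as Tonelli's theorem requires. *)
Definition positive_loss {R : realType} (L : R -> R) (t : R) : R :=
  if 0 < t then L t else 0.

Lemma measurable_ratio_density (R : realType) n1 a1 b1 a2 b2 (theta : param R) :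
  measurable_fun setT
    (fun u : (measurableTypeR R * measurableTypeR R) * measurableTypeR R =>
      ratio_density n1 a1 b1 a2 b2 theta u.1 u.2).
Proof.
pose RR := measurableTypeR R.
have m11 : measurable_fun setT (fun u : (RR * RR) * RR => u.1.1).
  exact: (measurableT_comp measurable_fst measurable_fst).
have m12 : measurable_fun setT (fun u : (RR * RR) * RR => u.1.2).
  exact: (measurableT_comp measurable_snd measurable_fst).
have mc (i : (RR * RR) * RR -> R) : measurable_fun setT i ->
    measurable_fun setT (fun u : (RR * RR) * RR => u.2 * i u).
  by move=> mi; exact: measurable_funM.
apply: measurable_funM; last exact: measurable_funX.
apply: measurable_funM; last first.
  apply: (measurableT_comp (measurable_gamma_pdf _ _ _ setT)); exact: mc.
apply: measurable_funM; last first.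
  exact: (measurableT_comp (measurable_gamma_pdf _ _ _ setT)).
by apply: (measurableT_comp (measurable_order_stat_pdf _ _ _ _ _)); exact: mc.
Qed.

Lemma ratio_density_ge0 (R : realType) n1 a1 b1 a2 b2 (theta : param R) z v :
  0 <= ratio_density n1 a1 b1 a2 b2 theta z v.
Proof.
have s0 := sigma1_gt0 theta.
have t0 : 0 < sigma2 theta := lt_le_trans s0 (sigma1_le_sigma2 theta).
apply: mulr_ge0; last exact: sqr_ge0.
by rewrite mulr_ge0 ?gamma_pdf_ge0// mulr_ge0 ?order_stat_pdf_ge0 ?gamma_pdf_ge0.
Qed.

Section conditional_risk.
Context {R : realType}.
Variables (n1 a1 b1 a2 b2 : nat) (L : R -> R) (beta : R).
Hypothesis ab1 : (a1 < b1)%N.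
Hypothesis ab2 : (a2 < b2)%N.
Let k := (b1 + b2 - (a1 + a2) + 1)%N.
Hypothesis dL : forall t : R, 0 < t -> derivable L t 1.
Hypothesis bowl : bowl_shaped L.
Hypothesis reg : gamma_regular L k.
Hypothesis beta_gt0 : 0 < beta.
Hypothesis beta_root : gamma_expectation k.+1 (fun y => derive1 L (y * beta)) = 0%E.
Hypothesis beta_unique : forall x : R, 0 < x ->
  gamma_expectation k.+1 (fun y => derive1 L (y * x)) = 0%E -> x = beta.

Let k_gt0 : (0 < k)%N. Proof. by rewrite /k addn1. Qed.
Let mL := gamma_regular_measurable L k reg.

(* The conditional risk of [x * V1] given [(Z1, Z2) = z], up to the density of
   [(Z1, Z2)] at [z]. *)
Definition conditional_risk (theta : param R) (z : R * R) (x : R) : \bar R :=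
  (\int[lebesgue_measure]_v ((positive_loss L (x * v / sigma1 theta))%:E
     * (ratio_density n1 a1 b1 a2 b2 theta z v)%:E))%E.

Section fixed.
Variables (theta : param R) (z : R * R).
Hypothesis z1_gt0 : 0 < z.1.
Hypothesis z2_gt0 : 0 < z.2.
Let s := sigma1 theta.
Let s0 : 0 < s := sigma1_gt0 theta.
Let m := 1 + z.1 + (n1 - a1 + 1)%:R * z.2.
Let m_gt0 : 0 < m.
Proof. by rewrite /m !addr_gt0// mulr_gt0// ltr0n addn1. Qed.
Let r := density_ratio n1 a1 theta z.
Let g := gamma_pdf k (1 : R).
Let mpos : measurable (pos : set (measurableTypeR R)).
Proof. exact: measurable_itv. Qed.

Let mr : measurable_fun (pos : set R) r.
Proof. exact: measurable_density_ratio. Qed.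

Let mg : measurable_fun (pos : set R) g.
Proof. exact: measurable_gamma_pdf. Qed.

Let mLk c : 0 < c -> measurable_fun (pos : set R) (fun w => L (c * w)).
Proof.
move=> c0; apply: (@measurable_comp _ _ _ _ _ _ (pos : set R)) => //.
move=> _ [w + <-]; rewrite /= !in_itv/= !andbT; exact: mulr_gt0.
Qed.

Let I (c : R) (h : R -> R) :=
  (\int[lebesgue_measure]_(w in pos) (L (c * w) * (h w * g w))%:E)%E.

(** Substitute [v = s / m * w]: then [x * v / s = x / m * w], so that the truncation bound
    [x = beta * m] becomes the scale [beta]. *)
Let conditional_riskE : exists2 D : R, 0 < D & forall x, 0 < x ->
  conditional_risk theta z x = (D%:E * I (x / m) r)%E.
Proof.
have [C C0 CE] := ratio_densityE n1 a1 b1 a2 b2 theta z ab1 ab2 z1_gt0 z2_gt0.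
have sm : 0 < s / m by rewrite divr_gt0.
exists (s / m * C); first exact: mulr_gt0.
move=> x x0; rewrite /conditional_risk.
(* The gamma density of [V1] vanishes for [v <= 0], and for [v > 0] the argument of the loss is
   positive. *)
transitivity (\int[lebesgue_measure]_(v in pos)
   (L (x * v / s) * ratio_density n1 a1 b1 a2 b2 theta z v)%:E)%E.
  rewrite [RHS]integral_mkcond; apply: eq_integral => v _.
  rewrite patchE; case: ifPn; rewrite ?inE ?notin_setE/= in_itv/= andbT => v0.
    by rewrite /positive_loss divr_gt0 ?mulr_gt0// EFinM.
  move/negP/negbTE : v0 => v0.
  by rewrite /ratio_density /gamma_pdf v0 mulr0 !mul0r mule0.
have mf : measurable_fun (pos : set R)
    (fun v => (L (x * v / s) * ratio_density n1 a1 b1 a2 b2 theta z v)%:E).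
  apply/measurable_EFinP; apply: measurable_funM; last first.
    apply: measurable_funTS.
    exact: (measurableT_comp (measurable_ratio_density R n1 a1 b1 a2 b2 theta)
      (pair1_measurable (z : measurableTypeR R * measurableTypeR R))).
  rewrite (_ : (fun v => L (x * v / s)) = fun v => L (x / s * v)).
    by apply: mLk; exact: divr_gt0.
  by apply/funext => v; rewrite mulrAC.
rewrite (integral_scale_itvoy _ (s / m) _ sm mf).
rewrite (EFinM (s / m)) -muleA; congr (_ * _)%E.
rewrite /I -ge0_integralZl//.
- apply: eq_integral => w; rewrite inE/= in_itv/= andbT => w0.
  rewrite CE// -EFinM; congr EFin.
  have -> : x * (s / m * w) / s = x / m * w.
    by field; rewrite !gt_eqF.
  by rewrite mulrCA.
- apply/measurable_EFinP; apply: measurable_funM; last exact: measurable_funM.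
  by apply: mLk; exact: divr_gt0.
- move=> w; rewrite /= in_itv/= andbT => w0; rewrite lee_fin mulr_ge0//.
    by apply: bowl_shaped_ge0 => //; rewrite mulr_gt0// divr_gt0.
  by rewrite mulr_ge0 ?gamma_pdf_ge0// density_ratio_ge0.
- by rewrite lee_fin ltW.
Qed.

Let I1E c : I c (cst 1%R) = gamma_expectation k (fun w => L (c * w)).
Proof. by apply: eq_integral => w _; rewrite /= mul1r. Qed.

Let I1_lt x : beta * m < x -> (I beta (cst 1%R) < I (x / m) (cst 1%R))%E.
Proof.
move=> bx; rewrite !I1E; apply: gamma_expectation_increasing => //.
by rewrite ltr_pdivlMr.
Qed.

Let I1_fin x : 0 < x -> (I (x / m) (cst 1%R) < +oo)%E.
Proof.
move=> x0; rewrite I1E; have [int _ _] := reg (x / m) (divr_gt0 x0 m_gt0).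
by rewrite ltey_eq (integrable_fin_num mpos int).
Qed.

Lemma conditional_risk_truncation_le x : beta * m < x ->
  (conditional_risk theta z (beta * m) <= conditional_risk theta z x)%E.
Proof.
move=> bx; have bm : 0 < beta * m by exact: mulr_gt0.
have x0 := lt_trans bm bx.
have [D D0 DE] := conditional_riskE.
rewrite !DE// mulfK ?gt_eqF// lee_pmul2l ?lte_fin//.
apply: bowl_integral_le => //.
- by move=> w _; exact: density_ratio_ge0.
- by move=> w _; exact: gamma_pdf_ge0.
- by move=> v w _; exact: density_ratio_nondecreasing.
- by rewrite ltr_pdivlMr.
- exact: I1_lt.
- exact: I1_fin.
Qed.

Lemma conditional_risk_truncation_lt x : mu1 theta = 0 -> beta * m < x ->
  (conditional_risk theta z x < +oo)%E ->
  (conditional_risk theta z (beta * m) < conditional_risk theta z x)%E.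
Proof.
move=> mu0 bx; have bm : 0 < beta * m by exact: mulr_gt0.
have x0 := lt_trans bm bx.
have [D D0 DE] := conditional_riskE.
rewrite !DE// mulfK ?gt_eqF// lte_pmul2l ?lte_fin// => fin.
apply: bowl_integral_lt => //.
- by move=> w _; exact: density_ratio_ge0.
- by move=> w _; exact: gamma_pdf_ge0.
- by move=> v w _; exact: density_ratio_nondecreasing.
- by rewrite ltr_pdivlMr.
- exact: I1_lt.
- exact: I1_fin.
- by move=> w w0; exact: density_ratio_gt0.
- rewrite ltey; apply: contraTneq fin => Iy.
  by rewrite /I Iy gt0_muley ?lte_fin.
Qed.

End fixed.
End conditional_risk.

Lemma positive_loss_ge0 (R : realType) (L : R -> R) t :
  bowl_shaped L -> 0 <= positive_loss L t.
Proof.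
by move=> bowl; rewrite /positive_loss; case: ifPn => // t0; exact: bowl_shaped_ge0.
Qed.

Lemma measurable_scaled_loss (R : realType) (L : R -> R) (phi : R * R -> R) (s : R) :
  measurable_fun (pos : set R) L ->
  measurable_fun setT (phi : measurableTypeR R * measurableTypeR R -> R) ->
  measurable_fun setT
    (fun u : (measurableTypeR R * measurableTypeR R) * measurableTypeR R =>
      (positive_loss L (phi u.1 * u.2 / s))%:E).
Proof.
move=> mL mphi.
have mpl : measurable_fun setT (positive_loss L).
  apply: measurable_fun_if => //; first exact: measurable_fun_ltr.
  apply: measurable_funS mL; first exact: measurable_itv.
  by move=> x [_ /= x0]; rewrite in_itv/= andbT x0.
apply/measurable_EFinP; apply: (measurableT_comp mpl).
apply: measurable_funM => //; apply: measurable_funM => //.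
exact: (measurableT_comp mphi measurable_fst).
Qed.

Lemma conditional_risk_ge0 (R : realType) n1 a1 b1 a2 b2 (L : R -> R) theta z x :
  bowl_shaped L -> (0 <= conditional_risk n1 a1 b1 a2 b2 L theta z x)%E.
Proof.
move=> bowl; apply: integral_ge0 => v _.
by rewrite mule_ge0// lee_fin ?positive_loss_ge0 ?ratio_density_ge0.
Qed.

Lemma measurable_conditional_risk (R : realType) n1 a1 b1 a2 b2 (L : R -> R)
    (phi : R * R -> R) theta :
  bowl_shaped L -> measurable_fun (pos : set R) L ->
  measurable_fun setT (phi : measurableTypeR R * measurableTypeR R -> R) ->
  measurable_fun setT (fun z : measurableTypeR R * measurableTypeR R =>
    conditional_risk n1 a1 b1 a2 b2 L theta z (phi z)).
Proof.
move=> bowl mL mphi.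
pose RR := measurableTypeR R.
apply: (measurable_fun_fubini_tonelli_F (m2 := @lebesgue_measure R)
  (fun u : (RR * RR) * RR =>
    ((positive_loss L (phi u.1 * u.2 / sigma1 theta))%:E
      * (ratio_density n1 a1 b1 a2 b2 theta u.1 u.2)%:E)%E)).
  apply: emeasurable_funM; first exact: measurable_scaled_loss.
  by apply/measurable_EFinP; exact: measurable_ratio_density.
by move=> u; rewrite mule_ge0// lee_fin ?positive_loss_ge0 ?ratio_density_ge0.
Qed.

(** * The risk as an integral over the ratios *)

Section censored.
Context {R : realType} {d : measure_display} {T : measurableType d}.
Variables (n1 a1 b1 n2 a2 b2 : nat) (theta : param R) (P : probability T R).
Variables (X1 X2 V1 V2 : {mfun T >-> R}).
Hypothesis law : censored_law n1 a1 b1 n2 a2 b2 theta P X1 X2 V1 V2.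

Let s0 : 0 < sigma1 theta := sigma1_gt0 theta.
Let t0 : 0 < sigma2 theta := lt_le_trans s0 (sigma1_le_sigma2 theta).

Lemma censored_law_expectation
    (F : (measurableTypeR R * measurableTypeR R) * measurableTypeR R -> \bar R) :
  measurable_fun setT F -> (forall u, 0 <= F u)%E ->
  (\int[P]_w F ((Z1 V1 V2 w, Z2 X1 V1 w), V1 w)
   = \int[lebesgue_measure2]_z \int[@lebesgue_measure R]_v
       (F (z, v) * (ratio_density n1 a1 b1 a2 b2 theta z v)%:E))%E.
Proof.
move=> mF F0; case: law => indep dX _ dV1 dV2.
(* The variables are repackaged with values in [measurableTypeR R], the space that carries Lebesgue
   measure. *)
have mR (X : {mfun T >-> R}) : measurable_fun setT (X : T -> measurableTypeR R).
  exact: (measurable_funP (D := setT) X).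
pose M (X : {mfun T >-> R}) : {mfun T >-> measurableTypeR R} :=
  HB.pack (X : T -> measurableTypeR R) (isMeasurableFun.Build _ _ _ _ _ (mR X)).
rewrite -(expectation_ratios_density _ _ _ P (M X1) (M V1) (M V2)
  (order_stat_pdf n1 a1 (mu1 theta) (sigma1 theta))
  (gamma_pdf (b1 - a1) (sigma1 theta)) (gamma_pdf (b2 - a2) (sigma2 theta)) F)//.
- move=> A B C mA mB mC.
  rewrite (_ : _ `&` _ = X1 @^-1` B `&` X2 @^-1` setT `&` V1 @^-1` C `&` V2 @^-1` A).
    rewrite indep// preimage_setT probability_setT mule1.
    by rewrite muleC muleA.
  by rewrite preimage_setT setIT -setIA setIC.
- exact: measurable_order_stat_pdf.
- exact: measurable_gamma_pdf.
- exact: measurable_gamma_pdf.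
- by move=> x; exact: order_stat_pdf_ge0.
- by move=> x; exact: gamma_pdf_ge0.
- by move=> x; exact: gamma_pdf_ge0.
- by move=> v v0; rewrite /gamma_pdf ltNge v0.
Qed.

Lemma gamma_law_nonpositive k (s : R) (V : {mfun T >-> R}) :
  has_density P V (gamma_pdf k s) -> P (V @^-1` `]-oo, 0]) = 0%E.
Proof.
move=> dV; have /= := dV `]-oo, 0]%classic (measurable_itv _).
rewrite /distribution /pushforward => ->.
apply: integral0_eq => x; rewrite /= in_itv/= => x0.
by rewrite /gamma_pdf ltNge x0.
Qed.

(** [V1] and [V2] are almost surely positive, so [delta] is prescribed only on that event; there the
    estimate is positive and [positive_loss L] agrees with [L]. *)
Lemma risk_conditional (L : R -> R) (phi : R * R -> R) (delta : T -> R)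
    (Q : param R -> probability T R) : Q theta = P ->
  bowl_shaped L -> measurable_fun (pos : set R) L ->
  measurable_fun setT (phi : measurableTypeR R * measurableTypeR R -> R) ->
  (forall z, 0 < phi z) ->
  (forall w, 0 < V1 w -> 0 < V2 w ->
    delta w = phi (Z1 V1 V2 w, Z2 X1 V1 w) * V1 w) ->
  risk L Q theta delta
  = (\int[lebesgue_measure2]_z
      conditional_risk n1 a1 b1 a2 b2 L theta z (phi z))%E.
Proof.
move=> QP bowl mL mphi phi0 deltaE.
pose RR := measurableTypeR R.
pose F (u : (RR * RR) * RR) := (positive_loss L (phi u.1 * u.2 / sigma1 theta))%:E.
have mF : measurable_fun setT F by exact: measurable_scaled_loss.
have F0 u : (0 <= F u)%E by rewrite lee_fin positive_loss_ge0.
transitivity (\int[P]_w F ((Z1 V1 V2 w, Z2 X1 V1 w), V1 w))%E; last first.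
  exact: censored_law_expectation.
case: law => _ _ _ dV1 dV2.
rewrite /risk unlock QP.
have mN (V : {mfun T >-> R}) : measurable (V @^-1` `]-oo, 0]).
  by apply: measurable_funPTI; exact: measurable_itv.
apply: (@eq_integral_off_null _ _ _ _
  (V1 @^-1` `]-oo, 0] `|` V2 @^-1` `]-oo, 0])).
- exact: measurableU.
- apply/eqP; rewrite -measure_le0 (le_trans (measureU2 _ _ _))//.
  rewrite [X in (X + _)%E](gamma_law_nonpositive _ _ _ dV1).
  by rewrite [X in (_ + X)%E](gamma_law_nonpositive _ _ _ dV2) adde0.
move=> w /=; rewrite !in_itv/= => /not_orP[/negP + /negP].
rewrite -!ltNge => v1 v2.
rewrite deltaE// /F /positive_loss ifT//.
by rewrite divr_gt0// mulr_gt0.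
Qed.

End censored.

(** * Domination by the truncated estimator *)

Theorem theorem2p3 (R : realType) (n1 a1 b1 n2 a2 b2 : nat)
  (ha1 : (1 <= a1)%N) (hab1 : (a1 < b1)%N) (hbn1 : (b1 <= n1)%N)
  (ha2 : (1 <= a2)%N) (hab2 : (a2 < b2)%N) (hbn2 : (b2 <= n2)%N)
  (a b : nat) (ha : a = (a1 + a2)%N) (hb : b = (b1 + b2)%N)
  (d : measure_display) (T : measurableType d)
  (P : param R -> probability T R) (X1 X2 V1 V2 : {mfun T >-> R})
  (hlaw : forall theta : param R,
    censored_law n1 a1 b1 n2 a2 b2 theta (P theta) X1 X2 V1 V2)
  (L : R -> R)
  (hLdiff : forall t : R, 0 < t -> derivable L t 1)
  (hLbowl : bowl_shaped L)
  (hLreg : gamma_regular L (b - a + 1))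
  (phi2 : R * R -> R)
  (hphi2_meas : measurable_fun [set z : R * R | 0 < z.1] phi2)
  (hphi2_gt0 : forall z1 z2 : R, 0 < z1 -> 0 < phi2 (z1, z2))
  (hrisk : forall theta : param R,
    (risk L P theta (estimator X1 V1 V2 phi2) < +oo)%E)
  (beta1 : R) (hbeta1_gt0 : 0 < beta1)
  (hbeta1 : gamma_expectation (b - a + 2) (fun y => derive1 L (y * beta1)) = 0%E)
  (hbeta1_unique : forall beta : R, 0 < beta ->
    gamma_expectation (b - a + 2) (fun y => derive1 L (y * beta)) = 0%E ->
    beta = beta1)
  (hprob : exists theta : param R,
    (0 < P theta [set w | [/\ (0 < Z1 V1 V2 w)%R, (0 < Z2 X1 V1 w)%R &
       (truncation_bound n1 a1 beta1 (Z1 V1 V2 w, Z2 X1 V1 w)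
         < phi2 (Z1 V1 V2 w, Z2 X1 V1 w))%R]])%E) :
  dominates L P (estimator_star X1 V1 V2 n1 a1 beta1 phi2)
                (estimator X1 V1 V2 phi2).
Proof.
have hk1 : (b - a + 1 = b1 + b2 - (a1 + a2) + 1)%N by rewrite ha hb.
have hk2 : (b - a + 2 = (b1 + b2 - (a1 + a2) + 1).+1)%N by rewrite ha hb addnS.
rewrite hk1 in hLreg; rewrite hk2 in hbeta1 hbeta1_unique.
pose RR := measurableTypeR R.
pose la2 := @lebesgue_measure2 R.
(* [phi2] is known to be measurable and positive for [z.1 > 0]. The value 1 elsewhere extends both
   properties to the plane, and affects only the null event [Z1 <= 0]. *)
pose phi (z : R * R) := if 0 < z.1 then phi2 z else 1.
pose cut (z : R * R) := (0 < z.1) && (0 < z.2).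
pose phis z := if cut z then Num.min (phi z) (truncation_bound n1 a1 beta1 z) else phi z.
have phiE z : 0 < z.1 -> phi z = phi2 z by rewrite /phi => ->.
have phi0 z : 0 < phi z.
  by rewrite /phi; case: ifPn => // z0; case: z z0 => z1 z2; exact: hphi2_gt0.
have bound0 z : cut z -> 0 < truncation_bound n1 a1 beta1 z.
  by case/andP => z1 z2; rewrite mulr_gt0// !addr_gt0// mulr_gt0// ltr0n addn1.
have phis0 z : 0 < phis z.
  by rewrite /phis; case: ifPn => // zc; rewrite lt_min phi0 bound0.
have m1 : measurable_fun setT (fst : RR * RR -> R) by exact: measurable_fst.
have m2 : measurable_fun setT (snd : RR * RR -> R) by exact: measurable_snd.
have mphi : measurable_fun setT (phi : RR * RR -> R).
  apply: measurable_fun_if => //.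
    by apply: measurable_fun_ltr.
  rewrite setTI.
  rewrite (_ : _ @^-1` _ = [set z : R * R | 0 < z.1])//.
have mbound : measurable_fun setT (truncation_bound n1 a1 beta1 : RR * RR -> R).
  apply: measurable_funM => //; apply: measurable_funD.
    exact: measurable_funD.
  exact: measurable_funM.
have mcut : measurable_fun setT (cut : RR * RR -> bool).
  by apply: measurable_and; apply: measurable_fun_ltr.
have mphis : measurable_fun setT (phis : RR * RR -> R).
  by apply: measurable_fun_ifT => //; exact: measurable_minr.
have mL : measurable_fun (pos : set R) L.
  exact: gamma_regular_measurable hLreg.
pose CR := conditional_risk n1 a1 b1 a2 b2 L.
have riskE theta : risk L P theta (estimator X1 V1 V2 phi2)
    = (\int[la2]_z CR theta z (phi z))%E.
  apply: (risk_conditional _ _ _ _ _ _ _ _ _ _ _ _ (hlaw theta)) => // w v1 v2.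
  by rewrite /estimator phiE//= divr_gt0.
have risksE theta : risk L P theta (estimator_star X1 V1 V2 n1 a1 beta1 phi2)
    = (\int[la2]_z CR theta z (phis z))%E.
  apply: (risk_conditional _ _ _ _ _ _ _ _ _ _ _ _ (hlaw theta)) => // w v1 v2.
  have z1 : 0 < Z1 V1 V2 w by rewrite divr_gt0.
  rewrite /estimator_star /estimator /phis /cut /= z1 /=.
  by case: ifPn => _; rewrite /phi_star phiE.
have CR0 theta z x : (0 <= CR theta z x)%E by exact: conditional_risk_ge0.
have mCR theta (psi : R * R -> R) : measurable_fun setT (psi : RR * RR -> R) ->
    measurable_fun setT (fun z : RR * RR => CR theta z (psi z)).
  exact: measurable_conditional_risk.
(* The two conditional risks differ only where the truncation is active, and there the estimate is
   lowered to a value of the form [beta * m]. *)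
have CR_le theta z : (CR theta z (phis z) <= CR theta z (phi z))%E.
  rewrite /phis; case: ifPn => // /andP[z1 z2].
  rewrite minEle; case: ifPn => //; rewrite -ltNge => bz.
  exact: conditional_risk_truncation_le.
split=> [theta|].
  rewrite riskE risksE; apply: ge0_le_integral => //; exact: mCR.
(* Strictness is sought at a parameter with [mu1 = 0], where the density ratio is positive
   throughout; [hprob] may concern another parameter. *)
pose theta0 : param R := Param 0 0 ltr01 (lexx 1).
exists theta0; rewrite riskE risksE.
pose B : set (RR * RR) :=
  [set z | cut z] `&` [set z | truncation_bound n1 a1 beta1 z < phi z].
have mB : measurable B.
  apply: measurableI.
    by rewrite -[X in measurable X]setTI; exact: mcut.
  have mlt : measurable_fun setT (fun z : RR * RR => truncation_bound n1 a1 beta1 z < phi z).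
    exact: measurable_fun_ltr.
  by rewrite -[X in measurable X]setTI; exact: mlt.
apply: (ge0_integral_lt _ _ _ _ _ _ B) => //.
- exact: mCR.
- exact: mCR.
- by rewrite -riskE.
(* The planar measure of [B] links the parameter of [hprob] to [theta0]: if [B] were null, the
   truncation event would have probability 0 under every parameter, since the ratios have a
   density. *)
- case: hprob => theta; apply: contraTneq => B0.
  rewrite -leNgt.
  pose F (u : (RR * RR) * RR) : \bar R := (\1_B u.1)%:E.
  have mF : measurable_fun setT F.
    have m1B : measurable_fun setT (\1_B : RR * RR -> R) by exact: measurable_indic.
    by apply/measurable_EFinP; exact: (measurableT_comp m1B measurable_fst).
  have F0 u : (0 <= F u)%E by rewrite lee_fin.
  have := censored_law_expectation _ _ _ _ _ _ _ _ _ _ _ _ (hlaw theta) F mF F0.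
  (* The inner integral vanishes for [z] outside [B], and [B] is assumed null. *)
  rewrite [X in _ = X -> _](@eq_integral_off_null _ _ _ la2 B _ (cst 0%E))//;
    last first.
    move=> z Bz; apply: integral0_eq => v _.
    by rewrite /F/= indicE memNset// mul0e.
  rewrite integral0 => E.
  pose Z (w : T) : RR * RR := (Z1 V1 V2 w, Z2 X1 V1 w).
  have mZ : measurable_fun setT Z.
    have mV : measurable_fun setT (fun w => (V1 w)^-1).
      exact: (measurableT_comp (measurable_inv R)).
    by apply: measurable_fun_pair; exact: measurable_funM.
  have mS : measurable (Z @^-1` B) by rewrite -[X in measurable X]setTI; exact: mZ.
  rewrite -E (_ : [set w | _] = Z @^-1` B); last first.
    apply/seteqP; split => w /=.
      by case=> z1 z2 bz; split; rewrite /= ?/cut /= ?z1 ?z2// phiE.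
    by move=> [/andP[z1 z2]] /=; rewrite phiE.
  by rewrite -[Z @^-1` B]setIT -integral_indic.
- move=> z [/andP[z1 z2] bz]; rewrite /phis /cut z1 z2 /= minEle leNgt bz /=.
  exact: conditional_risk_truncation_lt.
Qed.
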